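(* Let $X$ be an $E$-valued $\mathcal P$-polynomial process with action $T$ and suppose the standing assumption (A') in the context holds. Let $p,q\in\mathcal C\cap \mathcal L$ with $pq\in\mathcal C$ and define $$M_t^p := p(X_t) - \int_0^t \mathcal Gp(X_r)\,dr,\qquad M_t^q := q(X_t) - \int_0^t \mathcal Gq(X_r)\,dr$$ for any $t\geq0$ (these are martingales with finite second moments), and $a_{p,q}:=\mathcal G(pq)-p\,\mathcal Gq-q\,\mathcal Gp$. Then the predictable quadratic covariation of $M^p$ and $M^q$ is given by $$ \langle M^p,M^q\rangle_t = \int_0^t a_{p,q}(X_s)\, ds,\quad t\geq 0. $$
   Context: $\mathbb N=\{0,1,2,\dots\}$, $\mathbb R_+=[0,\infty)$, and the scalar field is $\mathbb F=\mathbb R$. $(\Omega,\mathfrak A,(\mathcal F_t)_{t\ge 0},P)$ is a filtered probability space and $E$ is a non-empty set. Polynomials: $\mathcal P$ is a vector space of functions $E\to\mathbb F$ containing all constant functions, together with a degree function $\deg:\mathcal P\to\mathbb N$ such that $\deg(p+q)\le\max\{\deg(p),\deg(q)\}$, $\deg(\lambda p)=\deg(p)$ for $p,q\in\mathcal P$, $\lambda\in\mathbb F\setminus\{0\}$, and $\deg(p)=0$ iff $p$ is constant. $\mathcal P_n:=\{p\in\mathcal P:\deg(p)\le n\}$. $\mathcal L$ is a fixed vector space complement of $\mathcal P_0$ in $\mathcal P_1$. Polynomial action: a family $T=(T_h)_{h\ge0}$ of linear operators on $\mathcal P$ with $\deg(T_hp)\le\deg(p)$, $T_0p=p$, $T_hT_k=T_{h+k}$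 for $h,k\ge0$, and $h\mapsto (T_hp)(x)$ right-continuous for all $p\in\mathcal P$, $x\in E$. Polynomial process: a function $X:\Omega\times\mathbb R_+\to E$ is an $E$-valued $\mathcal P$-polynomial process with action $T$ if for all $p\in\mathcal P$: $\mathbb E[|p(X_t)|]<\infty$ for $t\ge0$; $\mathbb E[p(X_{t+h})|\mathcal F_t]=T_hp(X_t)$ for $t,h\ge0$; $t\mapsto p(X_t)$ has càdlàg paths; $p(X_t)$ is $\mathcal F_t$-measurable for $t\ge0$. Standing assumption (A'): there is a complete norm $\|\cdot\|$ on $\mathcal P_4$ such that (1) $(T_h|_{\mathcal P_4})_{h\ge0}$ is a strongly continuous semigroup of bounded operators; (2) $\delta_x:\mathcal P_4\to\mathbb F$, $f\mapsto f(x)$ is continuous for every $x\in E$; (3) the linear functional $\Gamma:\mathcal P_4\to\mathbb F$, $p\mapsto\mathbb E[p(X_0)]$ is continuous. Also: (4) $\mathcal P_1$ separates the points of $E$; (5) $\mathbb F=\mathbb R$; (6) $\mathcal P_1\cdot\mathcal P_1\subseteq\mathcal P_2$ and $\mathcal P_2\cdot\mathcal P_2\subseteq\mathcal P_4$ (pointwise products). The subspaces $\mathcal P_n$, $n=0,\dots,4$, are closed (and $T$-invariant). $\mathcal C\subseteq\mathcal P_4$ is the domain of the generator of the strongly continuous semigroup $(T_h|_{\mathcal P_4})_{h\ge0}$, and for $p\in\mathcal C$, $\mathcal Gp=\lim_{h\searrow0}\frac{T_hp-p}{h}\in\mathcal P_4$ is that generator; $\mathcal Gp\in\mathcal P_n$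 for $p\in\mathcal C\cap\mathcal P_n$. *)

(* Defs.v *)
From HB Require Import structures.
From mathcomp Require Import all_boot all_order all_algebra.
From mathcomp Require Import all_classical all_reals all_analysis.

Set Implicit Arguments.
Unset Strict Implicit.
Unset Printing Implicit Defensive.

Import Order.TTheory GRing.Theory Num.Theory.
Import numFieldNormedType.Exports.

Local Open Scope classical_set_scope.
Local Open Scope ring_scope.

(* Time-indexed families are functions of a real number; only their values at
   times t >= 0 are ever constrained. *)

Section processes.
Context {d : measure_display} {Omega : measurableType d} {R : realType}.
Implicit Types (F : R -> set_system Omega) (P : probability Omega R).
Implicit Types (G : set_system Omega) (M N A : R -> Omega -> R).

(* No right-continuity or completeness is required. *)
Record filtration F : Prop := Filtration {
  filtration_sigma : forall t, 0 <= t -> sigma_algebra setT (F t) ;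
  filtration_sub : forall t, 0 <= t -> F t `<=` measurable ;
  filtration_mono : forall s t, 0 <= s -> s <= t -> F s `<=` F t }.

(* For a sigma-algebra G, the measurable sets of g_sigma_algebraType G are
   exactly the members of G. *)
Definition measurable_wrt G (Y : Omega -> R) : Prop :=
  measurable_fun [set: g_sigma_algebraType G] (Y : g_sigma_algebraType G -> R).

Definition adapted F M : Prop := forall t, 0 <= t -> measurable_wrt (F t) (M t).

(* Z is a version of E[Y | G]. *)
Record cond_exp P G (Y Z : Omega -> R) : Prop := CondExp {
  cond_exp_measurable : measurable_wrt G Z ;
  cond_exp_integrable : P.-integrable setT (EFin \o Z) ;
  cond_exp_integral : forall B, G B ->
    (\int[P]_(w in B) (Z w)%:E = \int[P]_(w in B) (Y w)%:E)%E }.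

Definition cadlag (f : R -> R) : Prop :=
  (forall t, 0 <= t -> f s @[s --> t^'+] --> f t) /\
  (forall t, 0 < t -> cvg (f s @[s --> t^'-])).

Definition cadlag_paths M : Prop := forall w, cadlag (M ^~ w).

Record martingale F P M : Prop := Martingale {
  martingale_adapted : adapted F M ;
  martingale_cadlag : cadlag_paths M ;
  martingale_integrable : forall t, 0 <= t ->
    P.-integrable setT (EFin \o M t) ;
  martingale_cond_exp : forall s t, 0 <= s -> s <= t ->
    cond_exp P (F s) (M t) (M s) }.

Definition square_integrable_martingale F P M : Prop :=
  martingale F P M /\
  forall t, 0 <= t -> P.-integrable setT (fun w => (M t w ^+ 2)%:E).

Definition time_space : set (R * Omega) := `[0, +oo[ `*` setT.

Definition predictable_rectangles F : set_system (R * Omega) :=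
  [set C | exists2 B, F 0 B & C = [set 0] `*` B] `|`
  [set C | exists s t B, [/\ 0 <= s, s <= t, F s B & C = `]s, t] `*` B]].

Definition predictable F A : Prop := forall B : set R, measurable B ->
  <<s time_space, predictable_rectangles F>>
    (time_space `&` (fun z => A z.1 z.2) @^-1` B).

(* The defining properties of the predictable quadratic covariation <M, N> of
   two square-integrable martingales; they determine A up to
   indistinguishability.  M 0 and N 0 need not vanish. *)
Record predictable_covariation F P M N A : Prop := PredictableCovariation {
  pcov_left : square_integrable_martingale F P M ;
  pcov_right : square_integrable_martingale F P N ;
  pcov_predictable : predictable F A ;
  pcov_cadlag : cadlag_paths A ;
  pcov_start : forall w, A 0 w = 0 ;
  pcov_finite_variation : forall w t, 0 <= t ->
    bounded_variation 0 t (A ^~ w) ;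
  pcov_martingale :
    martingale F P (fun t w => M t w * N t w - A t w) }.

End processes.

Section semigroup.
Context {R : realType} {B : normedModType R}.
Implicit Type S : R -> B -> B.

Record C0_semigroup S : Prop := C0Semigroup {
  C0_linear : forall h, 0 <= h -> linear (S h) ;
  C0_bounded : forall h, 0 <= h -> exists M : R, forall f, `|S h f| <= M * `|f| ;
  C0_id : forall f, S 0 f = f ;
  C0_add : forall h k, 0 <= h -> 0 <= k -> forall f, S h (S k f) = S (h + k) f ;
  C0_continuous : forall f, {within `[0, +oo[, continuous (S ^~ f)} }.

Definition generator_domain S : set B :=
  [set f | cvg (h^-1 *: (S h f - f) @[h --> 0^'+])].

Definition generator S (f : B) : B := lim (h^-1 *: (S h f - f) @[h --> 0^'+]).

End semigroup.

Section polynomials.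
Context {R : realType} {E : Type}.
(* R^o is R as a vector space over itself. *)
Local Notation V := (E -> R^o).
Implicit Types (Pol L : set V) (deg : V -> nat) (T : R -> V -> V).

Definition linear_subspace (W : set V) : Prop := submod_closed (mem W).

Record polynomial_space Pol deg : Prop := PolynomialSpace {
  pol_subspace : linear_subspace Pol ;
  pol_cst : forall c : R, Pol (cst c) ;
  pol_degD : forall p q, Pol p -> Pol q ->
    (deg (p + q)%R <= maxn (deg p) (deg q))%N ;
  pol_degZ : forall (a : R) p, a != 0 -> Pol p -> deg (a *: p) = deg p ;
  pol_deg0 : forall p, Pol p -> (deg p = 0%N <-> exists c : R, p = cst c) }.

Definition pol_le Pol deg n : set V := [set p | Pol p /\ (deg p <= n)%N].

Definition complement_in (W W0 L : set V) : Prop :=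
  [/\ linear_subspace L, L `<=` W, L `&` W0 = [set 0]
    & W `<=` [set p | exists l c, [/\ L l, W0 c & p = l + c]]].

(* T h is only meaningful on Pol. *)
Record polynomial_action Pol deg T : Prop := PolynomialAction {
  act_stable : forall h p, 0 <= h -> Pol p -> Pol (T h p) ;
  act_linear : forall h (a : R) p q, 0 <= h -> Pol p -> Pol q ->
    T h (a *: p + q) = a *: T h p + T h q ;
  act_deg : forall h p, 0 <= h -> Pol p -> (deg (T h p) <= deg p)%N ;
  act_id : forall p, Pol p -> T 0 p = p ;
  act_add : forall h k p, 0 <= h -> 0 <= k -> Pol p ->
    T h (T k p) = T (h + k) p ;
  act_right_continuous : forall p x t, 0 <= t -> Pol p ->
    (T h p x : R) @[h --> t^'+] --> (T t p x : R) }.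

Record polynomial_process {d} {Omega : measurableType d}
    (F : R -> set_system Omega) (P : probability Omega R)
    Pol T (X : R -> Omega -> E) : Prop := PolynomialProcess {
  proc_integrable : forall p t, Pol p -> 0 <= t ->
    P.-integrable setT (fun w => (p (X t w) : R)%:E) ;
  proc_cond_exp : forall p t h, Pol p -> 0 <= t -> 0 <= h ->
    cond_exp P (F t) (fun w => p (X (t + h) w)) (fun w => T h p (X t w)) ;
  proc_cadlag : forall p, Pol p -> cadlag_paths (fun t w => p (X t w)) ;
  proc_adapted : forall p, Pol p -> adapted F (fun t w => p (X t w)) }.

(* A complete norm on the space of polynomials of degree at most 4 is given as
   a Banach space B together with a linear isomorphism j of B onto that
   space. *)
Section banach.
Context {B : completeNormedModType R}.
Variables (j : {linear B -> V}) (T : R -> V -> V).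

(* The inverse of j; only meaningful on the range of j, as are gen on gen_dom
   and carre_du_champ p q for p, q and p \* q in gen_dom. *)
Definition coord (p : V) : B := xget 0 [set f | j f = p].

Definition T4 (h : R) (f : B) : B := coord (T h (j f)).

Definition gen_dom : set V := j @` generator_domain T4.

Definition gen (p : V) : V := j (generator T4 (coord p)).

Definition carre_du_champ (p q : V) : V := fun x =>
  gen (p \* q) x - p x * gen q x - q x * gen p x.

End banach.

Record standing_assumption {d} {Omega : measurableType d}
    (P : probability Omega R) Pol deg T (X : R -> Omega -> E)
    (B : completeNormedModType R) (j : {linear B -> V}) : Prop :=
  StandingAssumption {
  sa_inj : injective j ;
  sa_range : range j = pol_le Pol deg 4 ;
  sa_semigroup : C0_semigroup (T4 j T) ;
  sa_eval : forall x, continuous (fun f => j f x : R) ;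
  sa_initial : continuous (fun f => \int[P]_w (j f (X 0 w) : R)) ;
  sa_separates : forall x y,
    (forall p, pol_le Pol deg 1 p -> p x = p y) -> x = y ;
  sa_mul1 : forall p q, pol_le Pol deg 1 p -> pol_le Pol deg 1 q ->
    pol_le Pol deg 2 (p \* q) ;
  sa_mul2 : forall p q, pol_le Pol deg 2 p -> pol_le Pol deg 2 q ->
    pol_le Pol deg 4 (p \* q) ;
  sa_closed : forall n, (n <= 4)%N -> closed (j @^-1` pol_le Pol deg n) }.

Definition compensated {Omega : Type} (X : R -> Omega -> E) (p g : V)
    (t : R) (w : Omega) : R :=
  p (X t w) - \int[lebesgue_measure]_(r in `[0, t]) (g (X r w) : R).

End polynomials.

(* Main.v *)
Require Import Defs.
From HB Require Import structures.
From mathcomp Require Import all_boot all_order all_algebra.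
From mathcomp Require Import all_classical all_reals all_analysis.
From mathcomp Require Import measurable_realfun ring lra.

Import Order.TTheory GRing.Theory Num.Theory.
Import numFieldNormedType.Exports.

Local Open Scope classical_set_scope.
Local Open Scope ring_scope.

(* Write Y = p(X), Z = q(X), u = Gp(X), v = Gq(X) and U, V for the primitives of
   u, v, so that M^p = Y - U and M^q = Z - V.  The product rule for U V gives
     M^p M^q - int a = M^{pq} - (M^p V - int M^p v) - (M^q U - int M^q u),
   and each term is a martingale.  For M^f with f in the domain of the
   generator, the orbit t |-> T_t f x has right derivative T_t Gf x, hence
   T_t f x - f x = int_0^t T_r Gf x dr for every x, and Fubini moves the
   conditional expectation inside.  For M V - int M v with M a martingale, Fubini
   reduces the claim to E[(M_t - M_s) v_r | F_s] = 0 for r <= s <= t.  The second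
   moments needed are E[g(X_t)^2] = E[(T_t g^2)(X_0)] for g of degree at most 2,
   locally bounded in t because p |-> E[p(X_0)] is continuous. *)

(** * Cadlag paths and their primitives *)

Section cadlag_paths.
Set Implicit Arguments.
Unset Strict Implicit.
Context {R : realType}.
Implicit Types (f g : R -> R) (a b r s t : R).
Notation mu := (@lebesgue_measure R).

(** Degree 2 is the threshold behind all estimates: p, q and pq lie in P_2, the generator maps its
    domain within P_2 into P_2, and squares of elements of P_2 lie in P_4, where the norm lives. A
    single statement for degree at most 2 therefore serves M^p, M^q and M^{pq}. The process a(X) is
    controlled only in mean, as a combination of Gpq(X) and of products of two square-integrable
    processes; this suffices for its time integral. Nothing makes the filtration complete or
    right-continuous, so null sets cannot be discarded: time integrals are taken path by path, and
    their F_t-measurability comes from joint measurability of the integrand on [0, t] x Omega.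
    Martingale properties are checked as equalities of integrals over sets of F_s. Since U and V
    have finite variation, ordinary calculus on each path replaces stochastic integration. *)

Lemma cadlag_bounded f t : cadlag f ->
  exists2 C : R, 0 <= C & forall s, 0 <= s -> s <= t -> `|f s| <= C.
Proof.
move=> [rc ll].
have /compact_near_coveringP/near_covering_withinP nc := @segment_compact R 0 t.
have : \forall C \near +oo, `[0, t] `<=` (fun s => `|f s| <= C).
  (* By compactness of [0, t] a bound near each x suffices: one from the right limit, one from the
     left limit, and the value at x itself. *)
  apply: nc => x /=; rewrite in_itv/= => /andP[x0 xt].
  have [M Mx] : exists M, \forall s \near x, 0 <= s -> `|f s| <= M.
    have [M1 r1] : exists M, \forall s \near x^'+, `|f s| <= M.
      exists (`|f x| + 1).
      have /cvgrPdist_lt/(_ 1 ltr01) := rc _ x0.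
      apply: filterS => s; rewrite distrC => h.
      by rewrite -lerBlDl (le_trans (lerB_dist _ _))// ltW.
    have [M2 r2] : exists M, \forall s \near x^'-, 0 <= s -> `|f s| <= M.
      move: x0; rewrite le_eqVlt => /predU1P[<-|x0].
        (* To the left of 0 all times are negative, and no bound is claimed there. *)
        exists 0; near=> s => s0; exfalso.
        have : s < 0 by near: s; exact: nbhs_left_lt.
        by rewrite ltNge s0.
      have /cvg_ex[/= l fl] := ll _ x0.
      exists (`|l| + 1).
      have /cvgrPdist_lt/(_ 1 ltr01) := fl.
      apply: filterS => s; rewrite distrC => h _.
      by rewrite -lerBlDl (le_trans (lerB_dist _ _))// ltW.
    exists (Num.max `|f x| (Num.max M1 M2)).
    have : \forall s \near x, x < s -> `|f s| <= M1 by exact: r1.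
    have : \forall s \near x, s < x -> 0 <= s -> `|f s| <= M2 by exact: r2.
    apply: filterS2 => s h2 h1 s0.
    have [sx|sx|->] := ltgtP s x; rewrite !le_max ?lexx//.
    - by rewrite h2// !orbT.
    - by rewrite h1// orbT.
  have := Mx.
  have : \forall C \near +oo, M <= C by exact: (nbhs_pinfty_ge (num_real _)).
  move=> hC hx.
  exists ([set s | 0 <= s -> `|f s| <= M], [set C | M <= C]) => //=.
  move=> [s C] /= [h MC]; rewrite in_itv/= => /andP[s0 _].
  exact: (le_trans (h s0)).
move=> h.
have : \forall C \near +oo, 0 <= C /\ (`[0, t] `<=` (fun s => `|f s| <= C)).
  by near=> C; split; near: C => //; exact: (nbhs_pinfty_ge (num_real _)).
move=> /filter_ex[C [C0 hC]]; exists C => // s s0 st.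
by apply: hC; rewrite /= in_itv/= s0.
Unshelve. all: by end_near. Qed.

(** Round r up to the next multiple of 1/(n+1). The rounded process is constant in time on each
    cell, so preimages are countable unions of measurable rectangles, and it converges to Y by
    right-continuity. Rounding by floor plus one stays strictly above r, as the punctured filter at
    the right of r demands. *)
Lemma right_continuous_measurable d (T : measurableType d) (Y : R -> T -> R) :
  (forall r, measurable_fun setT (Y r)) ->
  (forall r w, Y s w @[s --> r^'+] --> Y r w) ->
  measurable_fun setT (fun z : R * T => Y z.1 z.2).
Proof.
move=> mY rc.
pose k n r : int := Num.floor (r * n.+1%:R).
pose g n (i : int) : R := (i + 1)%:~R / n.+1%:R.
apply: (@measurable_fun_cvg _ _ _ _ (fun n z => Y (g n (k n z.1)) z.2)).
- move=> n _ A mA; rewrite setTI.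
  rewrite (_ : _ @^-1` _ = \bigcup_(i : int)
      ((fun r => k n r) @^-1` [set i] `*` (Y (g n i) @^-1` A))); last first.
    apply/seteqP; split=> [[r w] /= h|[r w] /= [i _ [/= <-]]//].
    by exists (k n r).
  apply: countable_bigcupT_measurable => [|i]; first exact: countableP.
  apply: measurableX; last by rewrite -[X in measurable X]setTI; exact: mY.
  rewrite (_ : _ @^-1` _ = (fun r => r * n.+1%:R) @^-1` `[i%:~R, (i + 1)%:~R[).
    rewrite -[X in measurable X]setTI.
    by apply: (@measurable_funM _ _ _ _ id (cst n.+1%:R)) => //; exact: measurable_cst.
  apply/seteqP; split=> r /=; rewrite in_itv/=.
  - by move=> <-; rewrite Num.Theory.floor_le Num.Theory.floorD1_gt.
  - by move=> h; apply/eqP; rewrite /k floor_eq.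
- move=> [r w] _ /=.
  apply: (proj1 (cvg_at_rightP _ _ _) (rc r w) (fun n => g n (k n r))).
  have rg n : r < g n (k n r) by rewrite ltr_pdivlMr// Num.Theory.floorD1_gt.
  split=> //; apply: (@squeeze_cvgr _ _ _ _ (fun=> r) (fun n => r + harmonic n)).
  - apply: nearW => n; rewrite ltW//= ler_pdivrMr// mulrDl mulVf// intrD.
    by rewrite lerD2r Num.Theory.floor_le.
  - exact: cvg_cst.
  - by rewrite -[X in _ --> X]addr0; apply: cvgD; [exact: cvg_cst|exact: cvg_harmonic].
Qed.

(** A [cadlag] function is unconstrained at negative times; clamping the time at 0 makes it
    right-continuous on the whole line. *)
Lemma clamp_right_cvg f r : cadlag f ->
  f (Num.max 0 s) @[s --> r^'+] --> f (Num.max 0 r).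
Proof.
move=> [rc _]; have [r0|r0] := ltP r 0.
  apply: cvg_near_cst; near=> s; rewrite max_l//.
  by apply/ltW; near: s; exact: nbhs_right_lt.
apply: cvg_trans (rc _ r0).
apply: near_eq_cvg; near=> s; rewrite max_r//.
rewrite (le_trans r0)//; apply/ltW; near: s; exact: nbhs_right_gt.
Unshelve. all: by end_near. Qed.

Lemma cadlag_measurable f : cadlag f ->
  measurable_fun setT (fun r => f (Num.max 0 r)).
Proof.
move=> cf.
have h : measurable_fun setT (fun z : R * unit => f (Num.max 0 z.1)).
  apply: (@right_continuous_measurable _ _ (fun r (_ : unit) => f (Num.max 0 r))).
    by move=> r; exact: measurable_cst.
  by move=> r _; exact: clamp_right_cvg.
rewrite (_ : (fun _ => _) =
  (fun z : R * unit => f (Num.max 0 z.1)) \o (fun r => (r, tt)))//.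
apply: measurableT_comp => //; exact: measurable_fun_pair.
Qed.

Lemma integrable_cst_itv (b0 b1 : bool) a b C :
  mu.-integrable [set` Interval (BSide b0 a) (BSide b1 b)] (EFin \o cst C).
Proof.
apply: measurable_bounded_integrable => //.
- by rewrite /= lebesgue_measure_itv/=; case: ifP => _; rewrite -?EFinB ltry.
- by exists `|C|; split; rewrite ?num_real// => x Cx y _; exact: ltW.
Qed.

Lemma cadlag_integrable f a b : cadlag f -> 0 <= a ->
  mu.-integrable `[a, b] (EFin \o f).
Proof.
move=> cf a0; have [C C0 hC] := cadlag_bounded b cf.
apply: (@le_integrable _ _ _ mu _ _ _ (EFin \o cst C)) => //.
- apply/measurable_EFinP.
  apply: (eq_measurable_fun (fun r => f (Num.max 0 r))).
    by move=> r; rewrite inE/= in_itv/= => /andP[ar _]; rewrite max_r// (le_trans a0).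
  by apply: measurable_funTS; exact: cadlag_measurable.
- move=> r; rewrite /= in_itv/= => /andP[ar rb].
  by rewrite lee_fin [leRHS]ger0_norm// hC// (le_trans a0).
- exact: integrable_cst_itv.
Qed.

Lemma integrable_oc f a b : cadlag f -> 0 <= a -> mu.-integrable `]a, b] (EFin \o f).
Proof.
move=> cf a0; apply: integrableS (cadlag_integrable b cf a0) => //.
by apply: subset_itvr; rewrite bnd_simp.
Qed.

Lemma normr_Rintegral_le f a b C : a <= b ->
  mu.-integrable `]a, b] (EFin \o f) ->
  (forall r, a < r -> r <= b -> `|f r| <= C) ->
  `|\int[mu]_(r in `]a, b]) f r| <= C * (b - a).
Proof.
move=> ab fi fC; apply: (le_trans (le_normr_Rintegral _ fi)) => //.
have muab : fine (mu `]a, b]) = b - a.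
  rewrite /= lebesgue_measure_itv/= lte_fin; case: ltP => // ba.
  by rewrite (@le_anti _ _ a b) ?subrr// ab.
rewrite -muab -Rintegral_cst//; apply: le_Rintegral => //.
- exact: integrable_norm.
- exact: integrable_cst_itv.
- by move=> r /=; rewrite in_itv/= => /andP[]; exact: fC.
Qed.

Lemma primitiveB f s t : cadlag f -> 0 <= s -> s <= t ->
  \int[mu]_(r in `[0, t]) f r - \int[mu]_(r in `[0, s]) f r =
  \int[mu]_(r in `]s, t]) f r.
Proof.
move=> cf s0 st; apply: Rintegral_itvB; last 2 first.
- by rewrite bnd_simp.
- by rewrite bnd_simp.
- exact: cadlag_integrable.
Qed.

Lemma primitive_lipschitz f t C : cadlag f ->
  (forall r, 0 <= r -> r <= t -> `|f r| <= C) ->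
  forall r s, 0 <= r -> r <= s -> s <= t ->
  `|\int[mu]_(x in `[0, s]) f x - \int[mu]_(x in `[0, r]) f x| <= C * (s - r).
Proof.
move=> cf fC r s r0 rs st; rewrite primitiveB//.
apply: normr_Rintegral_le => //; first exact: integrable_oc.
by move=> x rx xs; rewrite fC ?(le_trans xs)// ltW// (le_lt_trans r0).
Qed.

Lemma primitive0 f t : t <= 0 -> \int[mu]_(r in `[0, t]) f r = 0.
Proof.
rewrite le_eqVlt => /predU1P[->|t0]; first by rewrite set_itv1 Rintegral_set1.
by rewrite set_itv_ge ?Rintegral_set0// bnd_simp -ltNge.
Qed.

Lemma primitive_continuous f t : cadlag f ->
  {for t, continuous (fun t => \int[mu]_(r in `[0, t]) f r)}.
Proof.
move=> cf; have [C C0 fC] := cadlag_bounded (t + 1) cf.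
have lip := primitive_lipschitz cf fC.
have lip' r s : r <= s -> s <= t + 1 ->
  `|\int[mu]_(x in `[0, s]) f x - \int[mu]_(x in `[0, r]) f x| <= C * (s - r).
  move=> rs st; have [r0|r0] := leP 0 r; first exact: lip.
  rewrite (primitive0 _ (ltW r0)); have [s0|s0] := leP 0 s.
    have := lip 0 s (lexx _) s0 st; rewrite (primitive0 _ (lexx 0)) => h.
    by apply: (le_trans h); rewrite ler_wpM2l//; lra.
  by rewrite (primitive0 _ (ltW s0)) subrr normr0 mulr_ge0// subr_ge0.
apply/cvgrPdist_le => /= e e0; near=> s.
have st : s <= t + 1.
  have : `|t - s| < 1 by near: s; apply/nbhs_ballP; exists 1 => /=.
  by rewrite ltr_norml => /andP[+ _]; lra.
(* The bound [C] may be 0, hence the divisor C + 1. *)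
have /= de : `|t - s| <= e / (C + 1).
  near: s; apply/nbhs_ballP; exists (e / (C + 1)) => /=.
    by rewrite divr_gt0// ltr_wpDl.
  by move=> x; exact: ltW.
apply: (@le_trans _ _ (C * `|t - s|)); last first.
  apply: (@le_trans _ _ ((C + 1) * `|t - s|)); first by rewrite ler_wpM2r// lerDl.
  by rewrite mulrC -ler_pdivlMr// ltr_wpDl.
have [ts|/ltW ts] := leP s t.
  by rewrite (@ger0_norm _ (t - s)) ?subr_ge0// lip'// lerDl.
by rewrite (distrC t) (@ger0_norm _ (s - t)) ?subr_ge0// distrC lip'.
Unshelve. all: by end_near. Qed.

(** Jordan decomposition: if C bounds |f| on [0, t], adding C s to the primitive makes it
    nondecreasing, and C s is nondecreasing too. *)
Lemma primitive_bounded_variation f t : cadlag f -> 0 <= t ->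
  bounded_variation 0 t (fun t => \int[mu]_(r in `[0, t]) f r).
Proof.
move=> cf; rewrite le_eqVlt => /predU1P[<-|t0]; first exact: bounded_variationxx.
have [C C0 fC] := cadlag_bounded t cf.
pose g s := \int[mu]_(r in `[0, s]) f r.
rewrite [X in bounded_variation _ _ X](_ : _ =
    (fun s => g s + C * s) \+ (\- (fun s => C * s))); last first.
  by apply/funext => s /=; rewrite addrK.
apply: bounded_variationD => //; last apply: bounded_variationN;
  apply: nondecreasing_bounded_variation => r s; rewrite !in_itv/= =>
  /andP[r0 _] /andP[_ st] rs.
  have := primitive_lipschitz cf fC r0 rs st.
  by rewrite -/(g s) -/(g r) ler_norml => /andP[+ _]; lra.
by rewrite ler_wpM2l.
Qed.

(** * Right derivatives and the fundamental theorem of calculus *)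

Definition right_derivative f t (l : R) :=
  h^-1 * (f (t + h) - f t) @[h --> 0^'+] --> l.

Lemma cvg_addl_right (t : R) : t + h @[h --> 0^'+] --> t^'+.
Proof.
move=> A; rewrite !near_simpl => -[e /= e0 eA]; exists e => //= h.
rewrite /ball_/= sub0r normrN => he h0; apply: eA => /=; last by rewrite ltrDl.
by rewrite /ball_/= opprD addrA subrr sub0r normrN.
Qed.

Lemma right_derivativeB f g t k l : right_derivative f t k ->
  right_derivative g t l -> right_derivative (fun s => f s - g s) t (k - l).
Proof.
move=> fk gl; rewrite /right_derivative [X in X @ _ --> _](_ : _ = (fun h =>
  h^-1 * (f (t + h) - f t) - h^-1 * (g (t + h) - g t))); first exact: cvgB.
by apply/funext => h; ring.
Qed.

Lemma right_derivativeM f g t k l : g s @[s --> t^'+] --> g t ->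
  right_derivative f t k -> right_derivative g t l ->
  right_derivative (fun s => f s * g s) t (k * g t + f t * l).
Proof.
move=> gt fk gl.
have gth : g (t + h) @[h --> 0^'+] --> g t.
  exact: (@cvg_comp _ _ _ (fun h => t + h) g _ _ _ (cvg_addl_right (t := t)) gt).
rewrite /right_derivative [X in X @ _ --> _](_ : _ = (fun h =>
  h^-1 * (f (t + h) - f t) * g (t + h) + f t * (h^-1 * (g (t + h) - g t)))).
  by apply: cvgD; [exact: cvgM|apply: cvgM => //; exact: cvg_cst].
by apply/funext => h; ring.
Qed.

Lemma primitive_right_derivative f t : cadlag f -> 0 <= t ->
  right_derivative (fun t => \int[mu]_(r in `[0, t]) f r) t (f t).
Proof.
move=> cf t0; apply/cvgrPdist_le => /= e e0.
have /cvgrPdist_le/(_ _ e0)/= : f s @[s --> t^'+] --> f t by exact: cf.1.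
move=> [d /= d0 hd]; near=> h.
have h0 : 0 < h by near: h; exact: nbhs_right_gt.
have hd' : h < d by near: h; exact: nbhs_right_lt.
have tth : t <= t + h by rewrite lerDl ltW.
have fi := integrable_oc (t + h) cf t0.
have muth : fine (mu `]t, (t + h)]) = h.
  by rewrite /= lebesgue_measure_itv/= lte_fin ltrDl h0/= addrAC subrr add0r.
have -> : \int[mu]_(r in `[0, t + h]) f r - \int[mu]_(r in `[0, t]) f r =
    \int[mu]_(r in `]t, (t + h)]) (f r - f t) + f t * h.
  rewrite primitiveB// RintegralB//; last exact: integrable_cst_itv.
  by rewrite Rintegral_cst// muth subrK.
rewrite mulrDr (mulrCA _ (f t)) mulVf ?gt_eqF// mulr1 opprD addrCA subrr addr0.
rewrite normrN normrM gtr0_norm ?invr_gt0// mulrC ler_pdivrMr//.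
rewrite -[in leRHS](addrK t h) [in leRHS](addrC h).
apply: normr_Rintegral_le => //.
  by rewrite -[EFin \o _]/((EFin \o f) \- (EFin \o cst (f t)))%E; apply: integrableB => //;
    exact: integrable_cst_itv.
move=> r tr rth; rewrite distrC; apply: hd => //=.
by rewrite ltr0_norm ?subr_lt0//; lra.
Unshelve. all: by end_near. Qed.

(** Fix a slope e > 0 and let c be the supremum of the times up to which |f r - f 0| <= e r.
    Left-continuity extends the inequality to c itself. If c < t, the zero right derivative at c
    gives |f r - f c| <= e (r - c) just after c, and adding the two inequalities contradicts the
    choice of c. *)
Lemma right_derivative0_cst f t :
  (forall t, 0 < t -> f s @[s --> t^'-] --> f t) ->
  (forall t, 0 <= t -> right_derivative f t 0) ->
  0 <= t -> f t = f 0.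
Proof.
move=> fl fr; rewrite le_eqVlt => /predU1P[<-//|t0].
suff fe e : 0 < e -> `|f t - f 0| <= e * t.
  apply/eqP; rewrite -subr_eq0 -normr_le0; apply/ler_addgt0Pl => e e0.
  by rewrite addr0 (le_trans (fe (e / t) _)) ?divr_gt0// divfK// gt_eqF.
move=> e0.
pose S := [set s | 0 <= s <= t /\ forall r, 0 <= r -> r <= s -> `|f r - f 0| <= e * r].
have S0 : S 0.
  split=> [|r r0 r0']; first by rewrite lexx ltW.
  by rewrite (@le_anti _ _ r 0) ?r0 ?r0'// subrr normr0 mulr0.
have Su : has_ubound S by exists t => s [/andP[]].
pose c := sup S.
have c0 : 0 <= c by exact: ub_le_sup.
have ct : c <= t by apply: ge_sup; [exists 0|move=> s [/andP[]]].
have Sc r : 0 <= r -> r < c -> `|f r - f 0| <= e * r.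
  by move=> r0 /(sup_gt (ex_intro _ _ S0))[s [_ Ss] /ltW rs]; exact: Ss.
have Scc : `|f c - f 0| <= e * c.
  move: c0; rewrite le_eqVlt => /predU1P[<-|c0].
    by rewrite subrr normr0 mulr0.
  have lcvg : `|f s - f 0| @[s --> c^'-] --> `|f c - f 0|.
    by apply: cvg_norm; apply: cvgB; [exact: fl|exact: cvg_cst].
  have rcvg : e * s @[s --> c^'-] --> e * c.
    by apply: cvg_at_left_filter; apply: cvgM; [exact: cvg_cst|exact: cvg_id].
  apply: (ler_cvg_to lcvg rcvg); near=> s; apply: Sc.
    by apply/ltW; near: s; exact: nbhs_left_gt.
  by near: s; exact: nbhs_left_lt.
move: ct; rewrite le_eqVlt => /predU1P[<-//|ct]; exfalso.
have /cvgrPdist_le/(_ _ e0)[d /= d0 hd] := fr _ c0.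
(* Difference quotients at [c] are at most [e] for increments below [d]; the half keeps r - c
   strictly below [d] for all r up to [s]. *)
pose s := Num.min t (c + d / 2).
have cs : c < s by rewrite lt_min ct/= ltrDl divr_gt0.
suff : S s by move=> /(ub_le_sup Su); rewrite leNgt cs.
split=> [|r r0].
  by rewrite (le_trans c0 (ltW cs))//= ge_min lexx.
rewrite le_min => /andP[rt rcd].
have [rc|cr|->//] := ltgtP r c; first exact: Sc.
have rc0 : 0 < r - c by rewrite subr_gt0.
have := hd (r - c); rewrite /= sub0r normrN gtr0_norm// => /(_ _ rc0).
rewrite sub0r normrN addrCA subrr addr0 normrM gtr0_norm ?invr_gt0// mulrC.
rewrite ler_pdivrMr// => h.
have {}h : `|f r - f c| <= e * (r - c) by apply: h; lra.
rewrite -(subrK (f c) (f r)) -addrA (le_trans (ler_normD _ _))//.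
by rewrite (le_trans (lerD h Scc))// -mulrDr subrK.
Unshelve. all: by end_near. Qed.

(* Left difference quotients of a semigroup orbit would require a locally uniform
   bound on the operators; right ones do not. *)
Lemma right_derivative_FTC f g t :
  (forall t, 0 < t -> f s @[s --> t^'-] --> f t) ->
  (forall t, 0 <= t -> right_derivative f t (g t)) ->
  cadlag g -> 0 <= t -> f t - f 0 = \int[mu]_(r in `[0, t]) g r.
Proof.
move=> fl fr cg t0.
pose G s := \int[mu]_(r in `[0, s]) g r.
have : f t - G t = f 0 - G 0.
  apply: (@right_derivative0_cst (fun s => f s - G s)) => // s s0.
    apply: cvgB; first exact: fl.
    by apply: cvg_at_left_filter; exact: primitive_continuous.
  rewrite -(subrr (g s)); apply: right_derivativeB; first exact: fr.
  exact: primitive_right_derivative.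
by rewrite /G (primitive0 _ (lexx 0)); lra.
Qed.

(** * Stability of càdlàg functions, and identities between primitives *)

Lemma cadlag_cst c : cadlag (cst c : R -> R).
Proof. by split=> t _; [exact: cvg_cst|exact: is_cvg_cst]. Qed.

Lemma cadlagD f g : cadlag f -> cadlag g -> cadlag (f \+ g).
Proof.
move=> [fr fl] [gr gl]; split=> t t0; first by apply: cvgD; [exact: fr|exact: gr].
by apply: is_cvgD; [exact: fl|exact: gl].
Qed.

Lemma cadlagB f g : cadlag f -> cadlag g -> cadlag (f \- g).
Proof.
move=> [fr fl] [gr gl]; split=> t t0; first by apply: cvgB; [exact: fr|exact: gr].
by apply: is_cvgB; [exact: fl|exact: gl].
Qed.

Lemma cadlagM f g : cadlag f -> cadlag g -> cadlag (f \* g).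
Proof.
move=> [fr fl] [gr gl]; split=> t t0; first by apply: cvgM; [exact: fr|exact: gr].
by apply: is_cvgM; [exact: fl|exact: gl].
Qed.

Lemma cadlag_primitive f : cadlag f ->
  cadlag (fun t => \int[mu]_(r in `[0, t]) f r).
Proof.
move=> cf; split=> t _.
- by apply: cvg_at_right_filter; exact: primitive_continuous.
- apply/cvg_ex; exists (\int[mu]_(r in `[0, t]) f r).
  by apply: cvg_at_left_filter; exact: primitive_continuous.
Qed.

Lemma eq_cadlag f g : (forall t, 0 <= t -> f t = g t) -> cadlag f -> cadlag g.
Proof.
move=> fg [fr fl]; split=> t t0.
- rewrite -fg//; apply: cvg_trans (fr _ t0); apply: near_eq_cvg; near=> s.
  by rewrite fg// (le_trans t0)// ltW//; near: s; exact: nbhs_right_gt.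
- have /cvg_ex[/= l ftl] := fl _ t0; apply/cvg_ex; exists l.
  apply: cvg_trans ftl; apply: near_eq_cvg; near=> s.
  by rewrite fg// ltW//; near: s; exact: nbhs_left_gt.
Unshelve. all: by end_near. Qed.

Lemma cadlag_shift f s : 0 <= s -> cadlag f -> cadlag (fun t => f (s + t)).
Proof.
move=> s0 [fr fl]; split=> t t0.
- apply: (@cvg_comp _ _ _ (fun h => s + h) f _ ((s + t)^'+)).
    move=> A [e /= e0 eA]; exists e => //= h het th.
    by apply: eA => /=; rewrite ?ltrD2l// opprD addrACA subrr add0r.
  by apply: fr; rewrite addr_ge0.
- have /cvg_ex[/= l ftl] := fl (s + t) (ltr_wpDl s0 t0).
  apply/cvg_ex; exists l; apply: (@cvg_comp _ _ _ (fun h => s + h) f) ftl.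
  move=> A [e /= e0 eA]; exists e => //= h het th.
  by apply: eA => /=; rewrite ?ltrD2l// opprD addrACA subrr add0r.
Qed.

(** In place of a change of variables: the primitive of f at s + t, as a function of t, has right
    derivative f (s + t). Writing s as s + 0 exhibits the left side as an increment from time 0. *)
Lemma primitive_shift f s t : cadlag f -> 0 <= s -> 0 <= t ->
  \int[mu]_(r in `[0, s + t]) f r - \int[mu]_(r in `[0, s]) f r =
  \int[mu]_(r in `[0, t]) f (s + r).
Proof.
move=> cf s0 t0; rewrite -[s in X in _ - X](addr0 s).
apply: (@right_derivative_FTC (fun t => \int[mu]_(r in `[0, s + t]) f r)) => //.
- move=> r r0; apply: cvg_at_left_filter.
  apply: (@cvg_comp _ _ _ (fun h => s + h) (fun t => \int[mu]_(r in `[0, t]) f r)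
    _ (nbhs (s + r))); last exact: primitive_continuous.
  by apply: cvgD; [exact: cvg_cst|exact: cvg_id].
- move=> r r0; have := primitive_right_derivative cf (addr_ge0 s0 r0).
  rewrite /right_derivative; apply: cvg_trans; apply: near_eq_cvg.
  by near=> h; rewrite addrA.
- exact: cadlag_shift.
Unshelve. all: by end_near. Qed.

(** The product of the two primitives vanishes at 0 and its right derivative is the integrand on the
    right. *)
Lemma primitiveM f g t : cadlag f -> cadlag g -> 0 <= t ->
  (\int[mu]_(r in `[0, t]) f r) * (\int[mu]_(r in `[0, t]) g r) =
  \int[mu]_(r in `[0, t]) (f r * (\int[mu]_(s in `[0, r]) g s) +
                          (\int[mu]_(s in `[0, r]) f s) * g r).
Proof.
move=> cf cg t0.
pose U s := \int[mu]_(r in `[0, s]) f r.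
pose V s := \int[mu]_(r in `[0, s]) g r.
transitivity (U t * V t - U 0 * V 0).
  by rewrite /U (primitive0 _ (lexx 0)) mul0r subr0.
apply: (@right_derivative_FTC (fun s => U s * V s)) => //.
- by move=> s s0; apply: cvgM; apply: cvg_at_left_filter; exact: primitive_continuous.
- move=> s s0; apply: right_derivativeM.
  + by apply: cvg_at_right_filter; exact: primitive_continuous.
  + exact: primitive_right_derivative.
  + exact: primitive_right_derivative.
- by apply: cadlagD; apply: cadlagM; rewrite ?/U ?/V //; exact: cadlag_primitive.
Qed.

Lemma primitiveB_cadlag f g t : cadlag f -> cadlag g ->
  \int[mu]_(r in `[0, t]) (f r - g r) =
  \int[mu]_(r in `[0, t]) f r - \int[mu]_(r in `[0, t]) g r.
Proof. by move=> cf cg; rewrite RintegralB//; exact: cadlag_integrable. Qed.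

(* The two sides differ by the product rule for [U t * V t]. *)
Lemma compensated_product y z u v g t : let U t := \int[mu]_(r in `[0, t]) u r in
  let V t := \int[mu]_(r in `[0, t]) v r in
  cadlag y -> cadlag z -> cadlag u -> cadlag v -> cadlag g ->
  (y t * z t - \int[mu]_(r in `[0, t]) g r) -
  ((y t - U t) * V t - \int[mu]_(r in `[0, t]) ((y r - U r) * v r)) -
  ((z t - V t) * U t - \int[mu]_(r in `[0, t]) ((z r - V r) * u r)) =
  (y t - U t) * (z t - V t) -
  \int[mu]_(r in `[0, t]) (g r - y r * v r - z r * u r).
Proof.
move=> U V cy cz cu cv cg.
have cU : cadlag U by exact: cadlag_primitive.
have cV : cadlag V by exact: cadlag_primitive.
have cyv := cadlagM cy cv; have cUv := cadlagM cU cv.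
have czu := cadlagM cz cu; have cVu := cadlagM cV cu.
have UV : U t * V t =
    \int[mu]_(r in `[0, t]) (U r * v r) + \int[mu]_(r in `[0, t]) (V r * u r).
  have [t0|/ltW t0] := leP 0 t; last by rewrite /U !(primitive0 _ t0) mul0r addr0.
  rewrite primitiveM// -RintegralD//; [|exact: cadlag_integrable|exact: cadlag_integrable].
  by apply: eq_Rintegral => r _; rewrite -/(U r) -/(V r) addrC (mulrC (u r)).
rewrite (primitiveB_cadlag _ (cadlagB cg cyv) czu) (primitiveB_cadlag _ cg cyv).
under [\int[mu]_(r in _) ((y r - U r) * v r)]eq_Rintegral do rewrite mulrBl.
under [\int[mu]_(r in _) ((z r - V r) * u r)]eq_Rintegral do rewrite mulrBl.
rewrite (primitiveB_cadlag _ cyv cUv) (primitiveB_cadlag _ czu cVu).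
move: (\int[mu]_(r in _) (U r * v r)) (\int[mu]_(r in _) (V r * u r)) UV => a b.
move: (\int[mu]_(r in _) (y r * v r)) (\int[mu]_(r in _) (z r * u r)) => e f.
move: (\int[mu]_(r in _) g r) (U t) (V t) (y t) (z t) => i U' V' y' z' UV.
by rewrite (_ : a = U' * V' - b); [ring|rewrite UV addrK].
Qed.

End cadlag_paths.

(** * Processes with locally bounded moments *)

Section processes.
Set Implicit Arguments.
Unset Strict Implicit.
Context {d : measure_display} {Omega : measurableType d} {R : realType}.
Context (P : probability Omega R).
Implicit Types (F : R -> set_system Omega) (G : set_system Omega).
Implicit Types (M Y Z : R -> Omega -> R) (f g : R -> R) (r s t : R).
Notation mu := (@lebesgue_measure R).

Lemma measurable_wrt_sub G G' (y : Omega -> R) : G `<=` G' ->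
  measurable_wrt G y -> measurable_wrt G' y.
Proof.
move=> GG' my _ B mB; have := my measurableT B mB.
by apply: sub_sigma_algebra2.
Qed.

Lemma measurable_wrt_measurable G (y : Omega -> R) : G `<=` measurable ->
  measurable_wrt G y -> measurable_fun setT y.
Proof.
move=> GG' my _ B mB; have := my measurableT B mB.
by apply: smallest_sub => //; exact: sigma_algebra_measurable.
Qed.

Lemma measurable_measurable_wrt (y : Omega -> R) :
  measurable_fun setT y -> measurable_wrt measurable y.
Proof.
by move=> my _ B mB; apply: sub_sigma_algebra; exact: my.
Qed.

(* Adaptedness to this filtration is mere measurability at each time, so that the
   results on adapted processes also cover non-adapted ones. *)
Lemma trivial_filtration : filtration (fun _ : R => @measurable _ Omega).
Proof. by split=> [t _|t _|s t _ _] //; exact: sigma_algebra_measurable. Qed.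

Lemma adapted_measurable F Y t : filtration F -> adapted F Y -> 0 <= t ->
  measurable_fun setT (Y t).
Proof.
move=> fF aY t0; apply: measurable_wrt_measurable (aY _ t0).
exact: filtration_sub fF _ t0.
Qed.

Lemma adapted_trivial F Y : filtration F -> adapted F Y ->
  adapted (fun=> measurable) Y.
Proof.
by move=> fF aY t t0; apply: measurable_measurable_wrt; exact: adapted_measurable aY t0.
Qed.

Let clamp_id r t : r \in `[0, t]%classic -> Num.max 0 (Num.min t r) = r.
Proof. by rewrite inE/= in_itv/= => /andP[r0 rt]; rewrite min_r// max_r. Qed.

(** Progressive measurability: when T is Omega with the sigma-algebra F_t, only the variables Y_r
    with r in [0, t] may be evaluated, so the time is clamped at both ends. The clamped paths remain
    right-continuous, being constant beyond t. *)
Lemma clamped_measurable d' (T : measurableType d') (Y : R -> T -> R) t :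
  0 <= t -> (forall w, cadlag (Y ^~ w)) ->
  (forall r, 0 <= r -> r <= t -> measurable_fun setT (Y r)) ->
  measurable_fun setT (fun z : R * T => Y (Num.max 0 (Num.min t z.1)) z.2).
Proof.
move=> t0 cY mY.
apply: (@right_continuous_measurable _ _ _
  (fun r w => Y (Num.max 0 (Num.min t r)) w)).
  move=> r; apply: mY; first by rewrite le_max lexx.
  by rewrite ge_max t0 ge_min lexx.
move=> r w; have [tr|rt] := leP t r; last first.
  apply: cvg_trans (clamp_right_cvg (r := r) (cY w)).
  apply: near_eq_cvg; near=> s; rewrite min_r//.
  by apply/ltW; near: s; exact: nbhs_right_lt.
apply: cvg_near_cst; near=> s; rewrite min_l//.
by rewrite (le_trans tr)// ltW//; near: s; exact: nbhs_right_gt.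
Unshelve. all: by end_near. Qed.

(** Tonelli is applied on the product of the line with (Omega, F_t), which yields F_t-measurability
    directly. Positive and negative parts are treated separately because only integrability along
    each path is known, none in w. *)
Lemma time_integral_adapted F Y : filtration F -> cadlag_paths Y -> adapted F Y ->
  adapted F (fun t w => \int[mu]_(r in `[0, t]) Y r w).
Proof.
move=> fF cY aY t t0; rewrite /measurable_wrt.
pose h (z : R * g_sigma_algebraType (F t)) :=
  (Y (Num.max 0 (Num.min t z.1)) z.2)%:E.
pose k := h \_ (`[0, t] `*` [set: g_sigma_algebraType (F t)]).
have mk : measurable_fun setT k.
  apply: (proj1 (measurable_restrictT _ (measurableX _ _))) => //.
  apply: measurable_funTS; apply/measurable_EFinP.
  apply: (@clamped_measurable _ (g_sigma_algebraType (F t))) => // r r0 rt.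
  by apply: measurable_wrt_sub (aY _ r0); exact: filtration_mono fF _ _ r0 rt.
apply/measurable_EFinP.
rewrite (_ : _ \o _ = (fun w => \int[mu]_r k^\+ (r, w) - \int[mu]_r k^\- (r, w))%E).
  apply: emeasurable_funB.
    by apply: measurable_fun_fubini_tonelli_G => //; exact: measurable_funepos.
  by apply: measurable_fun_fubini_tonelli_G => //; exact: measurable_funeneg.
apply/funext => w /=.
rewrite fineK; last first.
  by apply: integrable_fin_num => //; exact: cadlag_integrable.
rewrite integral_mkcond integralE; congr (_ - _)%E; apply: eq_integral => r _.
  rewrite !funeposE /k !patchE !in_setX in_setT andbT; case: ifPn => //.
  by move=> rt; rewrite /h/= clamp_id.
rewrite !funenegE /k !patchE !in_setX in_setT andbT; case: ifPn => //.
by move=> rt; rewrite /h/= clamp_id.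
Qed.

(** A bound uniform over [0, t], rather than integrability at each time, is what makes a process
    integrable on [0, t] x Omega. *)
Definition locally_bounded_mean Y := forall t, exists C : R, forall s,
  0 <= s -> s <= t -> (\int[P]_w `|(Y s w)%:E| <= C%:E)%E.

Record L1_process F Y : Prop := L1Process {
  L1_cadlag : cadlag_paths Y ;
  L1_adapted : adapted F Y ;
  L1_bounded : locally_bounded_mean Y }.

Record L2_process F Y : Prop := L2Process {
  L2_cadlag : cadlag_paths Y ;
  L2_adapted : adapted F Y ;
  L2_bounded : locally_bounded_mean (fun t w => Y t w ^+ 2) }.

Lemma L1_integrable F Y t : filtration F -> L1_process F Y -> 0 <= t ->
  P.-integrable setT (EFin \o Y t).
Proof.
move=> fF [cY aY bY] t0; apply/integrableP; split.
  by apply/measurable_EFinP; exact: adapted_measurable aY t0.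
have [C hC] := bY t.
by apply: le_lt_trans (hC t t0 (lexx _)) _; rewrite ltry.
Qed.

Lemma L1_trivial F Y : filtration F -> L1_process F Y ->
  L1_process (fun=> measurable) Y.
Proof. by move=> fF [cY aY bY]; split => //; exact: adapted_trivial aY. Qed.

(** The integrand is extended by zero off [0, t] x B, so that Fubini is used on the full product
    space while the clamp keeps it measurable. *)
Let clamped Y t (B : set Omega) : R * Omega -> \bar R :=
  (fun z => (Y (Num.max 0 (Num.min t z.1)) z.2)%:E) \_ (`[0, t] `*` B).

Let clampedE Y t B r w :
  clamped Y t B (r, w) = (((fun r => (Y r w)%:E) \_ `[0%R, t]) r * (\1_B w)%:E)%E.
Proof.
rewrite /clamped !patchE in_setX indicE/=; case: ifPn => [/andP[rt wB]|].
  by rewrite rt wB mule1 clamp_id.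
by rewrite negb_and; case: ifPn => /=; rewrite ?mul0e// => _ /negbTE ->; rewrite mule0.
Qed.

Let measurable_clamped Y t B : L1_process (fun=> measurable) Y -> 0 <= t ->
  measurable B -> measurable_fun setT (clamped Y t B).
Proof.
move=> [cY aY bY] t0 mB; apply: (proj1 (measurable_restrictT _ (measurableX _ _))) => //.
apply: measurable_funTS; apply/measurable_EFinP.
apply: clamped_measurable => // r r0 _.
exact: adapted_measurable trivial_filtration aY r0.
Qed.

Let clamped_bound Y t C : L1_process (fun=> measurable) Y -> 0 <= t ->
  (forall s, 0 <= s -> s <= t -> (\int[P]_w `|(Y s w)%:E| <= C%:E)%E) ->
  (\int[mu]_r \int[P]_w `|clamped Y t setT (r, w)| <= (C * t)%:E)%E.
Proof.
move=> Y1 t0 hC; have mk := measurable_clamped Y1 t0 measurableT.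
have C0 : 0 <= C.
  rewrite -lee_fin; apply: le_trans (hC _ (lexx _) t0); exact: integral_ge0.
apply: (@le_trans _ _ (\int[mu]_(r in `[0%R, t]) C%:E)%E).
  rewrite [leRHS]integral_mkcond; apply: ge0_le_integral => //.
  - by move=> r _; exact: integral_ge0.
  - apply: (@measurable_fun_fubini_tonelli_F _ _ _ _ _ P (abse \o clamped Y t setT)) => //.
      exact: measurableT_comp.
    by move=> z; exact: abse_ge0.
  - by apply: (proj1 (measurable_restrictT _ _)) => //; exact: measurable_cst.
  - move=> r _; rewrite patchE; case: ifPn => [|rN].
      rewrite inE/= in_itv/= => /andP[r0 rt].
      apply: le_trans (hC _ r0 rt); rewrite le_eqVlt; apply/orP; left; apply/eqP.
      apply: eq_integral => w _; rewrite clampedE patchE indicE in_setT mule1.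
      by rewrite ifT ?inE/= ?in_itv/= ?r0.
    rewrite integral0_eq// => w _; rewrite clampedE patchE.
    by rewrite (negbTE rN) mul0e abse0.
rewrite integral_cst//= lebesgue_measure_itv/= lte_fin.
case: ifP => t0'; first by rewrite -EFinB subr0 -EFinM.
by rewrite mule0 lee_fin mulr_ge0.
Qed.

Let clamped_integrable Y t B : L1_process (fun=> measurable) Y -> 0 <= t ->
  measurable B -> (mu \x P)%E.-integrable setT (clamped Y t B).
Proof.
move=> Y1 t0 mB.
have iT : (mu \x P)%E.-integrable setT (clamped Y t setT).
  apply/integrable12ltyP; first exact: measurable_clamped.
  have [C hC] := L1_bounded Y1 t.
  by apply: le_lt_trans (clamped_bound Y1 t0 hC) _; rewrite ltry.
apply: le_integrable iT => //; first exact: measurable_clamped.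
move=> [r w] _; rewrite !clampedE !indicE in_setT mule1 abseM.
by case: (_ \in _); rewrite ?abse0 ?abse1 ?mule1 ?mule0 ?abse_ge0.
Qed.

Let integral_clamped Y t B w : cadlag_paths Y ->
  (\int[mu]_r clamped Y t B (r, w) =
   ((fun w => (\int[mu]_(r in `[0%R, t]) Y r w)%:E) \_ B) w)%E.
Proof.
move=> cY; rewrite patchE; case: ifPn => wB.
  rewrite fineK; last first.
    by apply: integrable_fin_num => //; exact: cadlag_integrable.
  rewrite integral_mkcond; apply: eq_integral => r _.
  by rewrite clampedE indicE wB mule1.
rewrite integral0_eq// => r _.
by rewrite clampedE indicE (negbTE wB) mule0.
Qed.

Lemma time_integral_Fubini Y t B : L1_process (fun=> measurable) Y -> 0 <= t ->
  measurable B ->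
  (\int[P]_(w in B) (\int[mu]_(r in `[0%R, t]) Y r w)%:E =
   \int[mu]_(r in `[0%R, t]) \int[P]_(w in B) (Y r w)%:E)%E.
Proof.
move=> Y1 t0 mB.
rewrite integral_mkcond [RHS]integral_mkcond.
transitivity (\int[P]_w \int[mu]_r clamped Y t B (r, w))%E.
  by apply: eq_integral => w _; rewrite integral_clamped//; case: Y1.
rewrite -(Fubini (clamped_integrable Y1 t0 mB)).
apply: eq_integral => r _; rewrite patchE; case: ifPn => rt.
  rewrite [RHS]integral_mkcond; apply: eq_integral => w _.
  rewrite clampedE [in RHS]patchE patchE rt indicE.
  by case: ifPn; rewrite ?mule1 ?mule0.
by rewrite integral0_eq// => w _; rewrite clampedE patchE (negbTE rt) mul0e.
Qed.

Lemma time_integral_bound Y t C : L1_process (fun=> measurable) Y -> 0 <= t ->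
  (forall s, 0 <= s -> s <= t -> (\int[P]_w `|(Y s w)%:E| <= C%:E)%E) ->
  (\int[P]_w `|(\int[mu]_(r in `[0%R, t]) Y r w)%:E| <= (C * t)%:E)%E.
Proof.
move=> Y1 t0 hC; apply: le_trans (clamped_bound Y1 t0 hC).
have mk := measurable_clamped Y1 t0 measurableT.
have mak : measurable_fun setT (abse \o clamped Y t setT) by exact: measurableT_comp.
rewrite (fubini_tonelli (m1 := mu) (m2 := P) _ mak)//; last by move=> z; exact: abse_ge0.
have mI : measurable_fun setT
    (EFin \o (fun w => \int[mu]_(r in `[0%R, t]) Y r w)%R).
  apply/measurable_EFinP; case: Y1 => cY aY _.
  exact: (adapted_measurable trivial_filtration
    (time_integral_adapted trivial_filtration cY aY) t0).
apply: ge0_le_integral => //.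
- exact: measurableT_comp mI.
- by apply: measurable_fun_fubini_tonelli_G => // z; exact: abse_ge0.
- move=> w _; have -> : (\int[mu]_(r in `[0%R, t]) Y r w)%:E =
      (\int[mu]_r clamped Y t setT (r, w))%E.
    by rewrite integral_clamped ?patch_setT//; case: Y1.
  apply: le_abse_integral => //.
  by apply: measurableT_comp mk _; exact: measurable_pair2.
Qed.

Lemma time_integral_L1 F Y : filtration F -> L1_process F Y ->
  L1_process F (fun t w => \int[mu]_(r in `[0, t]) Y r w).
Proof.
move=> fF Y1; split.
- by move=> w; apply: cadlag_primitive; case: Y1.
- by apply: time_integral_adapted => //; case: Y1.
- move=> t; have [C hC] := L1_bounded Y1 t; exists (`|C| * `|t|) => s s0 st.
  apply: le_trans (time_integral_bound (L1_trivial fF Y1) s0 (C := C) _) _.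
    by move=> r r0 rs; apply: hC => //; exact: le_trans st.
  rewrite lee_fin (le_trans (ler_norm _))// normrM ler_wpM2l//.
  by rewrite !ger0_norm// (le_trans s0).
Qed.

End processes.

(** * Martingales *)

Section pull_out.
Import HBNNSimple.
Set Implicit Arguments.
Unset Strict Implicit.
Context {d : measure_display} {Omega : measurableType d} {R : realType}.
Context (P : probability Omega R) (G : set_system Omega).
Hypotheses (sG : sigma_algebra setT G) (Gm : G `<=` measurable).
Implicit Types (D xi : Omega -> R) (B : set Omega).

Let measurableG (A : set (g_sigma_algebraType G)) : measurable A -> G A.
Proof. by rewrite /measurable/= sigma_algebra_id. Qed.

Let GI A B : G A -> G B -> G (A `&` B).
Proof.
move=> GA GB; apply: measurableG.
by apply: measurableI; exact: sub_sigma_algebra.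
Qed.

Let pull_out_nnsfun D B (h : {nnsfun (g_sigma_algebraType G) >-> R}) :
  P.-integrable setT (EFin \o D) ->
  (forall B, G B -> \int[P]_(w in B) (D w)%:E = 0)%E -> G B ->
  (\int[P]_(w in B) (D w * h w)%:E = 0)%E.
Proof.
move=> iD D0 GB; have mB := Gm GB.
have GA (y : R) : G (h @^-1` [set y]).
  by apply: measurableG; exact: measurable_funPTI.
have iA y : P.-integrable B ((EFin \o D) \_ (h @^-1` [set y])).
  apply/integrable_restrict => //; first exact: Gm.
  by apply: integrableS iD => //; apply: measurableI => //; exact: Gm.
have cE y w : (D w * (y * \1_(h @^-1` [set y]) w))%:E =
    (y%:E * ((EFin \o D) \_ (h @^-1` [set y])) w)%E.
  rewrite mulrCA EFinM patchE indicE.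
  by case: (_ \in _); rewrite ?mulr1 ?mulr0.
under eq_integral => w _.
  rewrite fimfunEord mulr_sumr -sumEFin.
  under eq_bigr do rewrite cE.
  over.
rewrite integral_sum//; last by move=> i; apply: integrableZl.
rewrite big1// => i _; rewrite integralZl// -integral_mkcondr D0 ?mule0//.
exact: GI.
Qed.

Let pull_out_ge0 D xi B :
  P.-integrable setT (EFin \o D) ->
  (forall B, G B -> \int[P]_(w in B) (D w)%:E = 0)%E ->
  measurable_wrt G xi -> (forall w, 0 <= xi w) ->
  P.-integrable setT (fun w => (D w * xi w)%:E) -> G B ->
  (\int[P]_(w in B) (D w * xi w)%:E = 0)%E.
Proof.
move=> iD D0 mxi xi0 iDxi GB; have mB := Gm GB.
have mexi : measurable_fun [set: g_sigma_algebraType G] (EFin \o xi).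
  exact/measurable_EFinP.
(* The approximation is made over the sigma-algebra G, so the level sets of each [g n] belong to G;
   |D xi| dominates every D g_n. *)
pose g := nnsfun_approx measurableT mexi.
have exi0 (w : g_sigma_algebraType G) : setT w -> (0 <= (EFin \o xi) w)%E.
  by rewrite lee_fin.
have gxi w : g n w @[n --> \oo] --> xi w.
  exact: (fine_cvg (cvg_nnsfun_approx measurableT mexi exi0 I)).
have mg n : measurable_fun setT (g n : Omega -> R).
  by apply: (measurable_wrt_measurable Gm); exact: measurable_funPT.
have mD : measurable_fun setT D by apply/measurable_EFinP; exact: measurable_int iD.
have [|||||_ _] := @dominated_convergence _ _ _ P B mB (fun n w => (D w * g n w)%:E)
  (fun w => (D w * xi w)%:E) (fun w => `|(D w * xi w)%:E|%E).
- by move=> n; apply/measurable_EFinP/measurable_funTS/measurable_funM.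
- by apply: measurable_funTS; exact: measurable_int iDxi.
- apply: aeW => w _; apply: cvg_EFin; first exact: nearW.
  by apply: cvgM => //; exact: cvg_cst.
- by apply: integrableS (integrable_abse iDxi).
- apply: aeW => w n _; rewrite lee_fin !normrM ler_wpM2l//.
  rewrite !ger0_norm// -lee_fin /g nnsfun_approxE.
  exact: (le_approx n exi0).
have -> : [sequence (\int[P]_(w in B) (D w * g n w)%:E)%E]_n = cst 0%E.
  by apply/funext => n; exact: pull_out_nnsfun.
by move=> /(cvg_lim (@ereal_hausdorff R)) <-; rewrite lim_cst.
Qed.

(** D has conditional expectation zero given G, and a G-measurable factor xi preserves this. For
    simple xi the integral splits over level sets in G; dominated convergence gives xi >= 0. Both
    parts of xi are at most |xi|, so their products with D are again integrable. *)
Lemma pull_out D xi B :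
  P.-integrable setT (EFin \o D) ->
  (forall B, G B -> \int[P]_(w in B) (D w)%:E = 0)%E ->
  measurable_wrt G xi ->
  P.-integrable setT (fun w => (D w * xi w)%:E) -> G B ->
  (\int[P]_(w in B) (D w * xi w)%:E = 0)%E.
Proof.
move=> iD D0 mxi iDxi GB; have mB := Gm GB.
have iDp (z : Omega -> R) : measurable_wrt G z ->
    (forall w, `|z w| <= `|xi w|) ->
    P.-integrable setT (fun w => (D w * z w)%:E).
  move=> mz zxi; apply: le_integrable iDxi => //.
    apply/measurable_EFinP/measurable_funM.
      exact/measurable_EFinP/(measurable_int P).
    exact: measurable_wrt_measurable mz.
  by move=> w _; rewrite lee_fin !normrM ler_wpM2l.
have mp : measurable_wrt G xi^\+ by exact: measurable_funrpos.
have mn : measurable_wrt G xi^\- by exact: measurable_funrneg.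
have xa w : xi^\+ w + xi^\- w = `|xi w| by have /(congr1 (@^~ w)) := funrposDneg xi.
have xp w : `|xi^\+ w| <= `|xi w|.
  by rewrite -xa ger0_norm ?funrpos_ge0// lerDl funrneg_ge0.
have xn w : `|xi^\- w| <= `|xi w|.
  by rewrite -xa ger0_norm ?funrneg_ge0// lerDr funrpos_ge0.
have DE w : (D w * xi w)%:E = ((D w * xi^\+ w)%:E - (D w * xi^\- w)%:E)%E.
  by rewrite -EFinB -mulrBr -{1}[xi]funrposBneg.
under eq_integral do rewrite DE.
rewrite integralB_EFin//; last 2 first.
- by apply: integrableS (iDp _ mp xp).
- by apply: integrableS (iDp _ mn xn).
rewrite !pull_out_ge0 ?sube0//.
- exact: iDp mn xn.
- exact: iDp mp xp.
Qed.

End pull_out.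

(** * Algebra of processes with locally bounded first or second moments *)

Section process_algebra.
Set Implicit Arguments.
Unset Strict Implicit.
Context {d : measure_display} {Omega : measurableType d} {R : realType}.
Context (P : probability Omega R) (F : R -> set_system Omega).
Hypothesis fF : filtration F.
Implicit Types (M N Y Z v : R -> Omega -> R) (r s t : R).
Notation mu := (@lebesgue_measure R).

(** Two dominating processes fit all the elementary inequalities used below: |yz| <= y^2 + z^2, (y -
    z)^2 <= 2 (y^2 + z^2) and |y| <= y^2 + 1. The constant may depend on t, as it does for time
    integrals. *)
Lemma locally_bounded_mean_dom Y Z1 Z2 :
  (forall t, 0 <= t -> measurable_fun setT (Y t)) ->
  (forall t, 0 <= t -> measurable_fun setT (Z1 t)) ->
  (forall t, 0 <= t -> measurable_fun setT (Z2 t)) ->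
  locally_bounded_mean P Z1 -> locally_bounded_mean P Z2 ->
  (forall t, exists2 K, 0 <= K & forall s w, 0 <= s -> s <= t ->
    `|Y s w| <= K * (`|Z1 s w| + `|Z2 s w|)) ->
  locally_bounded_mean P Y.
Proof.
move=> mY m1 m2 b1 b2 dom t.
have [K K0 hK] := dom t; have [C1 h1] := b1 t; have [C2 h2] := b2 t.
exists (K * (C1 + C2)) => s s0 st.
have mn Z : (forall t, 0 <= t -> measurable_fun setT (Z t)) ->
    measurable_fun setT (fun w => `|(Z s w)%:E|%E).
  by move=> mZ; apply/measurable_EFinP/measurableT_comp => //; exact: mZ.
apply: (@le_trans _ _ (\int[P]_w (K%:E * (`|(Z1 s w)%:E| + `|(Z2 s w)%:E|)))%E).
  apply: ge0_le_integral => //.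
  - exact: mn.
  - by apply: emeasurable_funM => //; apply: emeasurable_funD; exact: mn.
  - by move=> w _; rewrite !abse_EFin -EFinD -EFinM lee_fin hK.
rewrite ge0_integralZl//; last 2 first.
- by apply: emeasurable_funD; exact: mn.
- by move=> w _; rewrite adde_ge0.
rewrite ge0_integralD//; [|exact: mn|exact: mn].
rewrite EFinM lee_wpmul2l//.
by rewrite EFinD leeD// ?h1 ?h2.
Qed.

Lemma locally_bounded_mean_cst (y : Omega -> R) : P.-integrable setT (EFin \o y) ->
  locally_bounded_mean P (fun=> y).
Proof.
move=> /integrableP[_ iy] t; exists (fine (\int[P]_w `|(y w)%:E|)%E) => s _ _.
by rewrite fineK// ge0_fin_numE//; exact: integral_ge0.
Qed.

Lemma adaptedB Y Z : adapted F Y -> adapted F Z ->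
  adapted F (fun t w => Y t w - Z t w).
Proof. by move=> aY aZ t t0; apply: measurable_funB; [exact: aY|exact: aZ]. Qed.

Lemma adaptedM Y Z : adapted F Y -> adapted F Z ->
  adapted F (fun t w => Y t w * Z t w).
Proof. by move=> aY aZ t t0; apply: measurable_funM; [exact: aY|exact: aZ]. Qed.

Lemma adapted_sqr Y : adapted F Y -> adapted F (fun t w => Y t w ^+ 2).
Proof.
move=> aY; rewrite (_ : (fun _ _ => _) = (fun t w => Y t w * Y t w)).
  exact: adaptedM.
by apply/funext => t; apply/funext => w; rewrite expr2.
Qed.

Lemma L1_processB Y Z : L1_process P F Y -> L1_process P F Z ->
  L1_process P F (fun t w => Y t w - Z t w).
Proof.
move=> [cY aY bY] [cZ aZ bZ]; split.
- by move=> w; apply: cadlagB; [exact: cY|exact: cZ].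
- exact: adaptedB.
- apply: (locally_bounded_mean_dom _ _ _ bY bZ) => [t|t|t|t].
  + exact: adapted_measurable (adaptedB aY aZ).
  + exact: adapted_measurable aY.
  + exact: adapted_measurable aZ.
  + by exists 1 => // s w _ _; rewrite mul1r ler_normB.
Qed.

Lemma L2_processM Y Z : L2_process P F Y -> L2_process P F Z ->
  L1_process P F (fun t w => Y t w * Z t w).
Proof.
move=> [cY aY bY] [cZ aZ bZ]; split.
- by move=> w; apply: cadlagM; [exact: cY|exact: cZ].
- exact: adaptedM.
- apply: (locally_bounded_mean_dom _ _ _ bY bZ) => [t|t|t|t].
  + exact: adapted_measurable (adaptedM aY aZ).
  + exact: adapted_measurable (adapted_sqr aY).
  + exact: adapted_measurable (adapted_sqr aZ).
  + exists 1 => // s w _ _; rewrite mul1r !normrX normrM.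
    by have := sqr_ge0 (`|Y s w| - `|Z s w|); nra.
Qed.

Lemma L2_processB Y Z : L2_process P F Y -> L2_process P F Z ->
  L2_process P F (fun t w => Y t w - Z t w).
Proof.
move=> [cY aY bY] [cZ aZ bZ]; split.
- by move=> w; apply: cadlagB; [exact: cY|exact: cZ].
- exact: adaptedB.
- apply: (locally_bounded_mean_dom _ _ _ bY bZ) => [t|t|t|t].
  + exact: adapted_measurable (adapted_sqr (adaptedB aY aZ)).
  + exact: adapted_measurable (adapted_sqr aY).
  + exact: adapted_measurable (adapted_sqr aZ).
  + exists 2 => // s w _ _; rewrite !(ger0_norm (sqr_ge0 _)).
    by have := sqr_ge0 (Y s w + Z s w); nra.
Qed.

Lemma L2_L1_process Y : L2_process P F Y -> L1_process P F Y.
Proof.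
move=> [cY aY bY]; split => //.
apply: (locally_bounded_mean_dom (Z2 := fun _ _ => 1) _ _ _ bY _) => [t|t|t||t].
+ exact: adapted_measurable aY.
+ exact: adapted_measurable (adapted_sqr aY).
+ by move=> _; exact: measurable_cst.
+ by apply: locally_bounded_mean_cst; exact: finite_measure_integrable_cst.
+ exists 1 => // s w _ _; rewrite mul1r normr1 normrX.
  by have := sqr_ge0 (`|Y s w| - 1); nra.
Qed.

Lemma L2_sqr_process Y : L2_process P F Y ->
  L1_process P F (fun t w => Y t w ^+ 2).
Proof.
move=> [cY aY bY]; split => //; last exact: adapted_sqr.
by move=> w; have := cadlagM (cY w) (cY w).
Qed.

(** Cauchy-Schwarz against the constant 1. With I the integral of f, J that of f^2 and c = I / t the
    mean, t times the nonnegative integral of (f - c)^2 equals t J - I^2. *)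
Lemma primitive_sqr_le (f : R -> R) t : cadlag f -> 0 <= t ->
  (\int[mu]_(r in `[0, t]) f r) ^+ 2 <= t * \int[mu]_(r in `[0, t]) f r ^+ 2.
Proof.
move=> cf; rewrite le_eqVlt => /predU1P[<-|t0].
  by rewrite (primitive0 _ (lexx 0)) mul0r expr0n.
set I := \int[mu]_(r in `[0, t]) f r.
pose c := I / t.
have cf2 : cadlag (fun r => f r ^+ 2) by have := cadlagM cf cf.
have cfc : cadlag (fun r => 2 * c * f r).
  by have := cadlagM (cadlag_cst (2 * c)) cf.
have : 0 <= \int[mu]_(r in `[0, t]) (f r - c) ^+ 2.
  by apply: Rintegral_ge0 => r _; exact: sqr_ge0.
have -> : \int[mu]_(r in `[0, t]) (f r - c) ^+ 2 =
    \int[mu]_(r in `[0, t]) f r ^+ 2 - 2 * c * I + c ^+ 2 * t.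
  transitivity (\int[mu]_(r in `[0, t]) (f r ^+ 2 - 2 * c * f r + c ^+ 2)).
    by apply: eq_Rintegral => r _; ring.
  have i2 := cadlag_integrable t cf2 (lexx 0).
  have i1 := cadlag_integrable t cfc (lexx 0).
  have i0 := cadlag_integrable t cf (lexx 0).
  have cB : cadlag (fun r => f r ^+ 2 - 2 * c * f r) by exact: cadlagB.
  rewrite RintegralD//; last 2 first.
  - exact: cadlag_integrable.
  - exact: integrable_cst_itv.
  rewrite RintegralB// RintegralZl// Rintegral_cst//; congr (_ + _ * _).
  by rewrite /= lebesgue_measure_itv/= lte_fin t0/= subr0.
move=> /(mulr_ge0 (ltW t0)); set J := \int[mu]_(r in `[0, t]) f r ^+ 2.
have -> : t * (J - 2 * c * I + c ^+ 2 * t) = t * J - I ^+ 2.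
  by rewrite /c; field; rewrite gt_eqF.
by rewrite subr_ge0.
Qed.

Lemma time_integral_L2 Y : L2_process P F Y ->
  L2_process P F (fun t w => \int[mu]_(r in `[0, t]) Y r w).
Proof.
move=> Y2; have [cY aY bY] := Y2.
have [cI aI bI] := time_integral_L1 fF (L2_sqr_process Y2).
have aV := time_integral_adapted fF cY aY.
split; [by move=> w; exact: cadlag_primitive|exact: aV|].
apply: (locally_bounded_mean_dom _ _ _ bI bI) => [t|t|t|t].
- exact: adapted_measurable (adapted_sqr aV).
- exact: adapted_measurable aI.
- exact: adapted_measurable aI.
(* The same process, the time integral of Y^2, fills both dominating slots; the absolute value keeps
   the constant nonnegative for t < 0. *)
- exists `|t| => // s w s0 st; rewrite ger0_norm ?sqr_ge0//.
  apply: le_trans (primitive_sqr_le (cY w) s0) _.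
  set J := Rintegral _ _ _.
  have J0 : 0 <= J by apply: Rintegral_ge0 => r _; exact: sqr_ge0.
  rewrite (ger0_norm J0) (ger0_norm (le_trans s0 st)); nra.
Qed.

Lemma L1_martingale M : L1_process P F M ->
  (forall s t B, 0 <= s -> s <= t -> F s B ->
    (\int[P]_(w in B) (M t w)%:E = \int[P]_(w in B) (M s w)%:E)%E) ->
  martingale F P M.
Proof.
move=> M1 hM; have [cM aM bM] := M1; split => //.
- by move=> t; exact: (L1_integrable fF M1).
- move=> s t s0 st; split; first exact: aM.
  + exact: (L1_integrable fF M1).
  + by move=> B FB; rewrite (hM s t).
Qed.

Lemma martingaleB M N : martingale F P M -> martingale F P N ->
  martingale F P (fun t w => M t w - N t w).
Proof.
move=> [aM cM iM eM] [aN cN iN eN].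
have iMN t : 0 <= t -> P.-integrable setT (EFin \o (fun w => M t w - N t w)).
  move=> t0; rewrite (_ : _ \o _ = (EFin \o M t) \- (EFin \o N t))%E//.
  by apply: integrableB => //; [exact: iM|exact: iN].
split => //; first exact: adaptedB.
  by move=> w; apply: cadlagB; [exact: cM|exact: cN].
move=> s t s0 st; have t0 := le_trans s0 st; split.
- exact: adaptedB.
- exact: iMN.
- move=> B FB; have mB : measurable B by exact: (filtration_sub fF s0).
  have iB (Z : Omega -> R) : P.-integrable setT (EFin \o Z) ->
      P.-integrable B (EFin \o Z) by exact: integrableS.
  rewrite !integralB_EFin//; try by apply: iB; first [exact: iM|exact: iN].
  by rewrite (cond_exp_integral (eM _ _ s0 st) FB) (cond_exp_integral (eN _ _ s0 st) FB).
Qed.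

Lemma L2_trivial Y : L2_process P F Y -> L2_process P (fun=> measurable) Y.
Proof. by move=> [cY aY bY]; split => //; exact: adapted_trivial aY. Qed.

(** A variable such as M_t frozen in time is not F_r-adapted for r < t; over the filtration of all
    measurable sets it becomes a process to which the product rules apply. *)
Lemma L2_cst (y : Omega -> R) : measurable_fun setT y ->
  P.-integrable setT (fun w => (y w ^+ 2)%:E) ->
  L2_process P (fun=> measurable) (fun=> y).
Proof.
move=> my iy; split; first by move=> w; exact: cadlag_cst.
- by move=> t _; exact: measurable_measurable_wrt.
- exact: locally_bounded_mean_cst.
Qed.

Lemma L2_sqr_integrable Y t : L2_process P F Y -> 0 <= t ->
  P.-integrable setT (fun w => (Y t w ^+ 2)%:E).
Proof. by move=> /L2_sqr_process/(L1_integrable fF); exact. Qed.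

End process_algebra.

(** * Martingales multiplied by time integrals *)

Section product.
Set Implicit Arguments.
Unset Strict Implicit.
Context {d : measure_display} {Omega : measurableType d} {R : realType}.
Context (P : probability Omega R) (F : R -> set_system Omega).
Hypothesis fF : filtration F.
Implicit Types (M N Y Z v : R -> Omega -> R) (r s t : R).
Notation mu := (@lebesgue_measure R).

Let increment_integrable M v r s t : L2_process P F M -> L2_process P F v ->
  0 <= r -> 0 <= s -> 0 <= t ->
  P.-integrable setT (fun w => ((M t w - M s w) * v r w)%:E).
Proof.
move=> M2 v2 r0 s0 t0.
have cst2 Y t' : L2_process P F Y -> 0 <= t' ->
    L2_process P (fun=> measurable) (fun=> Y t').
  move=> Y2 t'0; apply: L2_cst; last exact: (L2_sqr_integrable fF).
  by case: Y2 => _ aY _; exact: adapted_measurable aY t'0.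
have D2 := L2_processB trivial_filtration (cst2 _ _ M2 t0) (cst2 _ _ M2 s0).
have := L2_processM trivial_filtration D2 (cst2 _ _ v2 r0).
by move=> /(L1_integrable trivial_filtration)/(_ (lexx 0)).
Qed.

(** As r <= s, the variable v_r is F_s-measurable and can be pulled out, while M_t - M_s integrates
    to zero over every set of F_s. *)
Let increment_orthogonal M v r s t B : martingale F P M ->
  L2_process P F M -> L2_process P F v ->
  0 <= r -> r <= s -> s <= t -> F s B ->
  (\int[P]_(w in B) ((M t w - M s w) * v r w)%:E = 0)%E.
Proof.
move=> mM M2 v2 r0 rs st FB; have s0 := le_trans r0 rs; have t0 := le_trans s0 st.
have iM t' : 0 <= t' -> P.-integrable setT (EFin \o M t').
  exact: martingale_integrable mM t'.
have sFs := filtration_sub fF s0.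
apply: (pull_out (filtration_sigma fF s0) sFs) FB.
- rewrite (_ : _ \o _ = (EFin \o M t) \- (EFin \o M s))%E//.
  by apply: integrableB => //; exact: iM.
- move=> C FC; have mC := sFs _ FC.
  have iC t' : 0 <= t' -> P.-integrable C (EFin \o M t').
    by move=> t'0; apply: integrableS (iM _ t'0).
  under eq_integral do rewrite EFinB.
  rewrite integralB_EFin//; [|exact: iC|exact: iC].
  rewrite (cond_exp_integral (martingale_cond_exp mM s0 st) FC) subee//.
  by apply: integrable_fin_num => //; exact: iC.
- apply: measurable_wrt_sub (L2_adapted v2 r0).
  exact: filtration_mono fF _ _ r0 rs.
- exact: increment_integrable.
Qed.

(* For B in F_s, Fubini turns the integral over B of the process at time t into
   int_0^t E[1_B (M_t - M_r) v_r] dr, whose integrand vanishes for r > s and is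
   unchanged when M_t is replaced by M_s for r <= s. *)
Lemma martingale_integral_by_parts M v : martingale F P M ->
  L2_process P F M -> L2_process P F v ->
  martingale F P (fun t w => M t w * (\int[mu]_(r in `[0, t]) v r w) -
    \int[mu]_(r in `[0, t]) (M r w * v r w)).
Proof.
move=> mM M2 v2.
have [cM _ _] := M2; have [cv _ _] := v2.
have Mv1 := L2_processM fF M2 v2.
have N1 := L1_processB fF (L2_processM fF M2 (time_integral_L2 fF v2))
                          (time_integral_L1 fF Mv1).
apply: (L1_martingale fF N1) => s t B s0 st FB; have t0 := le_trans s0 st.
have mB := filtration_sub fF s0 FB.
have NE u : 0 <= u -> (\int[P]_(w in B) (M u w * (\int[mu]_(r in `[0%R, u]) v r w) -
      \int[mu]_(r in `[0%R, u]) (M r w * v r w))%:E =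
    \int[mu]_(r in `[0%R, u]) \int[P]_(w in B) ((M u w - M r w) * v r w)%:E)%E.
  move=> u0.
  (* The integrand (M_u - M_r) v_r anticipates the future through M_u, so Fubini is invoked over the
     trivial filtration. *)
  rewrite -(@time_integral_Fubini _ _ _ P (fun r w => (M u w - M r w) * v r w))//.
    apply: eq_integral => w _; congr EFin.
    have cMv : cadlag (fun r => M r w * v r w) by exact: cadlagM.
    rewrite -RintegralZl//; last exact: cadlag_integrable.
    rewrite -RintegralB//; last 2 first.
    - apply: (cadlag_integrable (f := fun r => M u w * v r w)) => //.
      by apply: (@cadlagM _ (cst (M u w))) => //; exact: cadlag_cst.
    - exact: cadlag_integrable.
    by apply: eq_Rintegral => r _; rewrite mulrBl.
  apply: (L2_processM trivial_filtration); last exact: (L2_trivial fF).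
  apply: (L2_processB trivial_filtration); last exact: (L2_trivial fF).
  apply: L2_cst; last exact: (L2_sqr_integrable fF).
  by case: M2 => _ aM _; exact: adapted_measurable aM u0.
rewrite !NE// integral_mkcond [RHS]integral_mkcond; apply: eq_integral => r _.
rewrite !patchE; case: ifPn => [|rt]; last first.
  rewrite ifF//; apply/negP => rs; move/negP: rt; apply.
  by move: rs; rewrite !inE/= !in_itv/= => /andP[-> /le_trans->].
rewrite inE/= in_itv/= => /andP[r0 rt].
have [rs|sr] := leP r s.
  rewrite ifT; last by rewrite inE/= in_itv/= r0.
  transitivity (\int[P]_(w in B) (((M t w - M s w) * v r w)%:E +
                                  ((M s w - M r w) * v r w)%:E))%E.
    by apply: eq_integral => w _; rewrite -EFinD -mulrDl addrA subrK.
  have iB a b : 0 <= a -> 0 <= b ->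
      P.-integrable B (EFin \o (fun w => (M a w - M b w) * v r w)).
    by move=> a0 b0; apply: integrableS (increment_integrable M2 v2 r0 b0 a0).
  rewrite integralD_EFin//; [|exact: iB|exact: iB].
  by rewrite increment_orthogonal// add0e.
rewrite ifF; last by apply/negbTE; rewrite notin_setE/= in_itv/= r0/= leNgt sr.
(* For r > s the increment already starts at r, and B lies in F_r since F_s is contained in F_r. *)
apply: increment_orthogonal => //.
by apply: (filtration_mono fF s0 (ltW sr)).
Qed.

End product.

(** * Orbits of strongly continuous semigroups *)

Lemma linear_scaleB {R : pzRingType} {U V : lmodType R} {g : U -> V} (a : R) (u v : U) :
  linear g ->
  g (a *: (u - v)) = a *: (g u - g v).
Proof.
move=> lg.
have g0 : g 0 = 0.
  by have := lg 1 0 0; rewrite !scale1r addr0 => /(congr1 (+%R^~ (- g 0)));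
    rewrite addrK subrr.
rewrite -[a *: (u - v)]addr0 lg g0 addr0; congr (_ *: _).
rewrite (_ : u - v = (-1) *: v + u); last by rewrite scaleN1r addrC.
by rewrite lg scaleN1r addrC.
Qed.

Section semigroup_orbit.
Set Implicit Arguments.
Unset Strict Implicit.
Context {R : realType} {B : normedModType R} (S : R -> B -> B).
Hypothesis hS : C0_semigroup S.
Notation mu := (@lebesgue_measure R).

Lemma C0_semigroup_cvg t (I : Type) (A : set_system I) (FA : Filter A) (u : I -> B) f :
  0 <= t -> u @ A --> f -> (fun i => S t (u i)) @ A --> S t f.
Proof.
move=> t0 uf; have [M SM] := C0_bounded hS t0.
have lS := C0_linear hS t0.
apply/cvgrPdist_le => e e0.
(* The constant [M] may be zero or negative; |M| + 1 is positive and still a bound. *)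
have M0 : 0 < `|M| + 1 by rewrite ltr_wpDl.
move/cvgrPdist_le: uf => /(_ (e / (`|M| + 1)) (divr_gt0 e0 M0)).
apply: filterS => i; rewrite ler_pdivlMr// => h.
have := linear_scaleB 1 f (u i) lS; rewrite !scale1r => <-.
apply: (le_trans (SM _)); apply: le_trans h.
rewrite mulrC ler_wpM2l// (le_trans (ler_norm _))// lerDl.
by [].
Qed.

Variables (l : B -> R^o).
Hypotheses (ll : linear l) (cl : continuous l).

Let orbit_within f : {within `[0, +oo[, continuous (fun t => l (S t f) : R)}.
Proof.
apply: (@within_continuous_comp B R R _ (S ^~ f) l); last exact: C0_continuous.
by move=> x _; exact: cl.
Qed.

Lemma orbit_left_continuous f t : 0 < t -> l (S s f) @[s --> t^'-] --> (l (S t f) : R).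
Proof.
move=> t0; have /continuous_within_itvcyP[h _] := @orbit_within f.
by apply: cvg_at_left_filter; apply: h; rewrite in_itv/= t0.
Qed.

Lemma orbit_cadlag f : cadlag (fun t => l (S t f)).
Proof.
have /continuous_within_itvcyP[h h0] := @orbit_within f.
split=> t; last by move=> t0; apply/cvg_ex; eexists; exact: (@orbit_left_continuous f t t0).
rewrite le_eqVlt => /predU1P[<-//|t0].
by apply: cvg_at_right_filter; apply: h; rewrite in_itv/= t0.
Qed.

(** By the semigroup law the right difference quotient at s is S_s applied to the one at 0, so its
    convergence uses only the boundedness of the single operator S_s. Applying l first keeps the
    integral scalar-valued. *)
Lemma orbit_FTC f t : generator_domain S f -> 0 <= t ->
  (l (S t f) : R) - l f = \int[mu]_(s in `[0, t]) (l (S s (generator S f)) : R).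
Proof.
move=> Df t0; rewrite -{2}(C0_id hS f).
apply: (@right_derivative_FTC _ (fun s => l (S s f) : R)) => //; last exact: orbit_cadlag.
  by move=> s; exact: orbit_left_continuous.
move=> s s0; rewrite /right_derivative.
have : (l (S s (h^-1 *: (S h f - f))) : R) @[h --> 0^'+] -->
    (l (S s (generator S f)) : R).
  apply: (@cvg_comp _ _ _ (fun h => S s (h^-1 *: (S h f - f))) l); last exact: cl.
  exact: C0_semigroup_cvg.
apply: cvg_trans; apply: near_eq_cvg; near=> h.
have h0 : 0 <= h by apply/ltW; near: h; exact: nbhs_right_gt.
rewrite (linear_scaleB _ _ _ (C0_linear hS s0)) (C0_add hS s0 h0).
exact: (linear_scaleB _ _ _ ll).
Unshelve. all: by end_near. Qed.

End semigroup_orbit.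

Section cond_exp.
Set Implicit Arguments.
Unset Strict Implicit.
Context {d : measure_display} {Omega : measurableType d} {R : realType}.
Context (P : probability Omega R).

(** The set where Z >= 0 and its complement belong to G. On the first, |Z| = Z integrates like Y,
    and on the second, |Z| = - Z integrates like - Y; both are at most |Y|. *)
Lemma cond_exp_contraction (G : set_system Omega) (Y Z : Omega -> R) :
  sigma_algebra setT G -> G `<=` measurable -> cond_exp P G Y Z ->
  P.-integrable setT (EFin \o Y) ->
  (\int[P]_w `|(Z w)%:E| <= \int[P]_w `|(Y w)%:E|)%E.
Proof.
move=> sG Gm [mZ iZ ZY] iY.
pose A := [set w | 0 <= Z w].
have GA : G A.
  rewrite -(sigma_algebra_id sG).
  have := mZ measurableT `[0, +oo[%classic (measurable_itv _).
  by rewrite setTI; congr (_ _); apply/seteqP; split=> w /=; rewrite in_itv/= andbT.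
have GAC : G (~` A).
  by rewrite -(sigma_algebra_id sG); apply: (@measurableC _ (g_sigma_algebraType G));
    exact: sub_sigma_algebra.
have mA := Gm _ GA; have mAC := Gm _ GAC.
have split_int (f : Omega -> R) : P.-integrable setT (EFin \o f) ->
    (\int[P]_w `|(f w)%:E| = \int[P]_(w in A) `|(f w)%:E| + \int[P]_(w in ~` A) `|(f w)%:E|)%E.
  move=> fi; rewrite -{1}(setUv A) ge0_integral_setU//.
  - by rewrite setUv; apply: measurableT_comp => //; exact: measurable_int fi.
  - by apply/disj_setPS => w [].
have iS (f : Omega -> R) C : P.-integrable setT (EFin \o f) -> measurable C ->
    P.-integrable C (EFin \o f).
  by move=> fi mC; exact: integrableS fi.
have habs (f : Omega -> R) C : P.-integrable setT (EFin \o f) -> measurable C ->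
    P.-integrable C (fun w => `|(f w)%:E|%E).
  by move=> fi mC; apply: (integrableS _ _ _ (integrable_abse fi)).
rewrite !split_int//; apply: leeD.
- rewrite (eq_integral (fun w => (Z w)%:E)); last first.
    by move=> w; rewrite inE => /= Zw; rewrite ger0_norm.
  rewrite ZY//; apply: le_integral => //; [exact: iS|exact: habs|].
  by move=> w _; rewrite lee_fin ler_norm.
- rewrite (eq_integral (fun w => - (Z w)%:E)%E); last first.
    move=> w; rewrite inE => /= /negP; rewrite -ltNge => Zw.
    by rewrite ltr0_norm.
  rewrite integralN/=; last exact: (integrable_add_def mAC (iS _ _ iZ mAC)). 
  rewrite ZY// -integralN/=; last exact: (integrable_add_def mAC (iS _ _ iY mAC)).
  apply: le_integral => //; [|exact: habs|].
    exact: (integrableN (iS _ _ iY mAC)).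
  by move=> w _; rewrite lee_fin -normrN ler_norm.
Qed.

End cond_exp.

(** * Polynomial processes *)

Section polynomial_space.
Set Implicit Arguments.
Unset Strict Implicit.
Context {R : realType} {E : Type} {Pol : set (E -> R^o)} {deg : (E -> R^o) -> nat}.
Hypothesis hPol : polynomial_space Pol deg.
Implicit Types (p q : E -> R^o) (n : nat).

Lemma pol_linear (a : R) p q : Pol p -> Pol q -> Pol (a *: p + q).
Proof.
move=> Pp Pq; have [_ lc] := pol_subspace hPol.
by have := lc a p q (mem_set Pp) (mem_set Pq); rewrite inE.
Qed.

Lemma pol_scale (a : R) p : Pol p -> Pol (a *: p).
Proof.
move=> Pp; rewrite -[a *: p]addr0; apply: pol_linear => //.
exact: (pol_cst hPol 0).
Qed.

Lemma pol_leZ (a : R) p n : pol_le Pol deg n p -> pol_le Pol deg n (a *: p).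
Proof.
move=> [Pp pn]; split; first exact: pol_scale.
have [->|a0] := eqVneq a 0; last by rewrite (pol_degZ hPol).
rewrite scale0r (_ : deg 0 = 0%N)//.
by apply/(pol_deg0 hPol (pol_cst hPol 0)); exists 0.
Qed.

Lemma pol_leD p q n : pol_le Pol deg n p -> pol_le Pol deg n q ->
  pol_le Pol deg n (p + q).
Proof.
move=> [Pp pn] [Pq qn]; split; first by rewrite -[p]scale1r; exact: pol_linear.
by rewrite (leq_trans (pol_degD hPol Pp Pq))// geq_max pn.
Qed.

Lemma pol_leB p q n : pol_le Pol deg n p -> pol_le Pol deg n q ->
  pol_le Pol deg n (p - q).
Proof. by move=> pn qn; apply: pol_leD => //; rewrite -scaleN1r; exact: pol_leZ. Qed.

Lemma pol_le_leq p m n : (m <= n)%N -> pol_le Pol deg m p -> pol_le Pol deg n p.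
Proof. by move=> mn [Pp pm]; split=> //; exact: leq_trans mn. Qed.

End polynomial_space.

(** * The semigroup on polynomials of degree at most 4 *)

Section polynomial_semigroup.
Set Implicit Arguments.
Unset Strict Implicit.
Context {R : realType} {d : measure_display} {Omega : measurableType d}.
Context {P : probability Omega R} {E : Type}.
Context {Pol : set (E -> R^o)} {deg : (E -> R^o) -> nat}.
Context {T : R -> (E -> R^o) -> (E -> R^o)} {X : R -> Omega -> E}.
Context {B : completeNormedModType R} {j : {linear B -> (E -> R^o)}}.
Hypotheses (hPol : polynomial_space Pol deg) (hT : polynomial_action Pol deg T).
Hypothesis hA : standing_assumption P Pol deg T X j.
Implicit Types (p q : E -> R^o) (n : nat) (f : B).
Notation mu := (@lebesgue_measure R).

Lemma j_pol_le f : pol_le Pol deg 4 (j f).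
Proof. by rewrite -(sa_range hA); exists f. Qed.

Lemma j_coord p : pol_le Pol deg 4 p -> j (Defs.coord j p) = p.
Proof.
rewrite -(sa_range hA) => -[f _ jf].
have : exists g, [set g | j g = p] g by exists f.
by move=> /(xgetPex 0).
Qed.

Lemma coord_j f : Defs.coord j (j f) = f.
Proof. by apply: (sa_inj hA); exact: j_coord (j_pol_le f). Qed.

Lemma action_pol_le h p n : 0 <= h -> pol_le Pol deg n p -> pol_le Pol deg n (T h p).
Proof.
move=> h0 [Pp pn]; split; first exact: (act_stable hT).
by rewrite (leq_trans (act_deg hT h0 Pp)).
Qed.

Lemma j_T4 h f : 0 <= h -> j (T4 j T h f) = T h (j f).
Proof. by move=> h0; apply: j_coord; apply: action_pol_le => //; exact: j_pol_le. Qed.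

(** The difference quotients stay in P_n because the action does not raise degrees, and P_n is
    closed, so their limit stays there too. *)
Lemma gen_pol_le p n : (n <= 4)%N -> gen_dom j T p -> pol_le Pol deg n p ->
  pol_le Pol deg n (gen j T p).
Proof.
move=> n4 [f Df <-] pn; rewrite /gen coord_j.
apply: (@closed_cvg _ _ (0^'+) _ (fun h => h^-1 *: (T4 j T h f - f))
  (fun g => pol_le Pol deg n (j g)) (sa_closed hA n4)); last exact: Df.
near=> h; have h0 : 0 <= h by apply/ltW; near: h; exact: nbhs_right_gt.
have lj : linear (j : B -> E -> R^o) by move=> a u v; exact: linearP.
rewrite (linear_scaleB _ _ _ lj) j_T4//; apply: (pol_leZ hPol); apply: (pol_leB hPol) => //.
exact: action_pol_le.
Unshelve. all: by end_near. Qed.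

Let eval_linear x : linear (fun f => j f x : R^o).
Proof. by move=> a u v; rewrite linearP. Qed.

Let eval_continuous x : continuous (fun f => j f x : R).
Proof. exact: (sa_eval hA). Qed.

Lemma action_cadlag p x : pol_le Pol deg 4 p ->
  exists2 f : R -> R, cadlag f & forall h, 0 <= h -> f h = T h p x.
Proof.
move=> p4; exists (fun h => j (T4 j T h (Defs.coord j p)) x).
  exact: (@orbit_cadlag _ _ _ (sa_semigroup hA) (fun f => j f x) (@eval_continuous x)).
by move=> h h0; rewrite j_T4// j_coord.
Qed.

Lemma action_FTC p x t : gen_dom j T p -> 0 <= t ->
  (T t p x : R) - p x = \int[mu]_(s in `[0, t]) (T s (gen j T p) x : R).
Proof.
move=> [f Df <-] t0.
have := orbit_FTC (sa_semigroup hA) (eval_linear x) (@eval_continuous x) Df t0.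
rewrite j_T4// => ->; apply: eq_Rintegral => s.
rewrite inE/= in_itv/= => /andP[s0 _].
by rewrite j_T4// /gen coord_j.
Qed.

End polynomial_semigroup.

(** * Moments of the process and its martingales *)

Section polynomial_process.
Set Implicit Arguments.
Unset Strict Implicit.
Context {R : realType} {d : measure_display} {Omega : measurableType d}.
Context {P : probability Omega R} {F : R -> set_system Omega} {E : Type}.
Context {Pol : set (E -> R^o)} {deg : (E -> R^o) -> nat}.
Context {T : R -> (E -> R^o) -> (E -> R^o)} {X : R -> Omega -> E}.
Context {B : completeNormedModType R} {j : {linear B -> (E -> R^o)}}.
Hypotheses (fF : filtration F) (hPol : polynomial_space Pol deg).
Hypotheses (hT : polynomial_action Pol deg T) (hX : polynomial_process F P Pol T X).
Hypothesis hA : standing_assumption P Pol deg T X j.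
Implicit Types (p q g : E -> R^o) (n : nat) (f : B).
Notation mu := (@lebesgue_measure R).

Let fin_sube_exchange (a b c e : \bar R) :
  a \is a fin_num -> b \is a fin_num -> c \is a fin_num -> e \is a fin_num ->
  (a - b = c - e -> a - c = b - e)%E.
Proof.
case: a b c e => [a| |] [b| |] [c| |] [e| |]//= _ _ _ _ [abce].
by congr EFin; lra.
Qed.

Let sigma_algebra_setT (G : set_system Omega) : sigma_algebra setT G -> G setT.
Proof. by move=> [G0 GC _]; rewrite -(setD0 setT); exact: GC. Qed.

(** Strong continuity makes the expectation of (T_s f)(X_0) continuous in s, and the bound is its
    maximum on [0, t]. A one-sided bound is enough, since it is applied to squares. *)
Lemma expectation_locally_bounded f t : 0 <= t ->
  exists C : R, forall s, 0 <= s -> s <= t ->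
  (\int[P]_w (j f (X s w) : R)%:E <= C%:E)%E.
Proof.
move=> t0.
pose Gam (g : B) : R := \int[P]_w (j g (X 0 w) : R).
have cG : continuous Gam by exact: (sa_initial hA).
have wG : {within `[0, +oo[, continuous (fun s => Gam (T4 j T s f))}.
  apply: (@within_continuous_comp B R R _ (fun s => T4 j T s f) Gam).
    by move=> x _; exact: cG.
  exact: (C0_continuous (sa_semigroup hA)).
have wGt : {within `[0, t], continuous (fun s => Gam (T4 j T s f))}.
  apply: continuous_subspaceW wG => s /=; rewrite !in_itv/= andbT.
  by move=> /andP[].
have [c _ hc] := EVT_max t0 wGt.
exists (Gam (T4 j T c f)) => s s0 st.
have [jP _] := j_pol_le hA f.
rewrite -[leLHS]fineK; last exact: integrable_fin_num (proc_integrable hX jP s0).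
rewrite lee_fin.
have := cond_exp_integral (proc_cond_exp hX jP (lexx 0) s0)
  (sigma_algebra_setT (filtration_sigma fF (lexx 0))).
rewrite add0r => <-.
have := hc s; rewrite in_itv/= s0 => /(_ st); apply: le_trans.
by rewrite /Gam /Rintegral (j_T4 hT hA).
Qed.

Lemma polynomial_L2 p : pol_le Pol deg 2 p -> L2_process P F (fun t w => p (X t w) : R).
Proof.
move=> p2; have Pp := p2.1.
have pp4 := sa_mul2 hA p2 p2.
split; [exact: (proc_cadlag hX Pp)|exact: (proc_adapted hX Pp)|].
move=> t; have [t0|t0] := leP 0 t; last first.
  by exists 0 => s s0 st; have := le_lt_trans (le_trans s0 st) t0; rewrite ltxx.
have [C hC] := expectation_locally_bounded (Defs.coord j (p \* p)) t0.
exists C => s s0 st; apply: le_trans (hC s s0 st).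
rewrite (j_coord hA pp4) le_eqVlt; apply/orP; left; apply/eqP.
by apply: eq_integral => w _; rewrite abse_EFin ger0_norm ?sqr_ge0// expr2.
Qed.

(** Dynkin's formula on a set of F_s: the orbit identity holds at every point of E, hence at X_s(w);
    after the exchange of integrals, conditioning turns T_v Gp(X_s) into Gp(X_{s+v}). *)
Lemma action_time_integral p s u C : gen_dom j T p -> pol_le Pol deg 2 p ->
  0 <= s -> 0 <= u -> F s C ->
  (\int[P]_(w in C) (T u p (X s w) - p (X s w) : R)%:E =
   \int[mu]_(v in `[0%R, u]) \int[P]_(w in C) (gen j T p (X (s + v) w) : R)%:E)%E.
Proof.
move=> Dp p2 s0 u0 FC; have mC := filtration_sub fF s0 FC.
set g := gen j T p.
have g2 : pol_le Pol deg 2 g by exact: (gen_pol_le hPol hT hA).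
have g4 : pol_le Pol deg 4 g by exact: pol_le_leq g2.
have Pg := g2.1.
have g1 := L2_L1_process fF (polynomial_L2 g2).
pose Z (v : R) (w : Omega) : R := T v g (X s w).
have Z1 : L1_process P (fun=> measurable) Z.
  split.
  - move=> w; have [f cf fE] := action_cadlag hT hA (X s w) g4.
    exact: eq_cadlag cf.
  - move=> v v0; apply: measurable_measurable_wrt.
    apply: (adapted_measurable fF (Y := fun t w => T v g (X t w))) => //.
    by apply: (proc_adapted hX); exact: (act_stable hT).
  (* T_v g(X_s) is a version of E[g(X_{s+v}) | F_s], so its mean absolute value is at most that of
     g(X_{s+v}), with s + v <= s + t. *)
  - move=> t; have [K hK] := L1_bounded g1 (s + t); exists K => v v0 vt.
    rewrite /Z; apply: le_trans (hK (s + v) _ _); last 2 first.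
    + by rewrite addr_ge0.
    + by rewrite lerD2l.
    apply: cond_exp_contraction (proc_cond_exp hX Pg s0 v0) _.
    + exact: (filtration_sigma fF s0).
    + exact: (filtration_sub fF s0).
    + by apply: (proc_integrable hX Pg); rewrite addr_ge0.
transitivity (\int[P]_(w in C) (\int[mu]_(v in `[0%R, u]) Z v w)%:E)%E.
  apply: eq_integral => w _; congr EFin.
  exact: (action_FTC hT hA (X s w) Dp u0).
rewrite (time_integral_Fubini Z1 u0 mC); apply: eq_integral => v.
rewrite inE/= in_itv/= => /andP[v0 vu].
exact: (cond_exp_integral (proc_cond_exp hX Pg s0 v0) FC).
Qed.

Lemma compensated_L2 p : gen_dom j T p -> pol_le Pol deg 2 p ->
  L2_process P F (compensated X p (gen j T p)).
Proof.
move=> Dp p2; apply: (L2_processB fF); first exact: polynomial_L2.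
apply: (time_integral_L2 fF); apply: polynomial_L2.
exact: (gen_pol_le hPol hT hA).
Qed.

Lemma compensated_martingale p : gen_dom j T p -> pol_le Pol deg 2 p ->
  martingale F P (compensated X p (gen j T p)).
Proof.
move=> Dp p2; have M2 := compensated_L2 Dp p2.
have Pp := p2.1.
have g2 : pol_le Pol deg 2 (gen j T p) by exact: (gen_pol_le hPol hT hA).
have gL2 := polynomial_L2 g2.
have cg w : cadlag (fun r => gen j T p (X r w) : R) by case: gL2.
apply: (L1_martingale fF (L2_L1_process fF M2)) => s t C s0 st FC.
have t0 := le_trans s0 st; have mC := filtration_sub fF s0 FC.
have u0 : 0 <= t - s by rewrite subr_ge0.
pose I r w : R := \int[mu]_(v in `[0, r]) (gen j T p (X v w) : R).
have iI r : 0 <= r -> P.-integrable C (EFin \o I r).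
  move=> r0; apply: integrableS (L1_integrable fF _ r0) => //.
  exact: (time_integral_L1 fF (L2_L1_process fF gL2)).
have ip r : 0 <= r -> P.-integrable C (EFin \o (fun w => p (X r w) : R)).
  by move=> r0; apply: integrableS (proc_integrable hX Pp r0).
(* Over C the increments of p(X) and of the time integral agree. Exchanging terms to compare times t
   and s needs all four integrals finite, since they are extended reals. *)
have E1 : (\int[P]_(w in C) (p (X t w) : R)%:E - \int[P]_(w in C) (p (X s w) : R)%:E =
    \int[P]_(w in C) (I t w)%:E - \int[P]_(w in C) (I s w)%:E)%E.
  rewrite -[RHS]integralB_EFin//; [|exact: iI|exact: iI].
  have := proc_cond_exp hX Pp s0 u0; rewrite subrKC => ce.
  rewrite -(cond_exp_integral ce FC) -integralB_EFin//; last 2 first.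
  - by apply: integrableS (cond_exp_integrable ce).
  - exact: ip.
  under eq_integral do rewrite -EFinB.
  rewrite (action_time_integral Dp p2 s0 u0 FC).
  rewrite -(@time_integral_Fubini _ _ _ P (fun v w => gen j T p (X (s + v) w)))//.
    apply: eq_integral => w _; rewrite -EFinB; congr EFin.
    by rewrite -(primitive_shift (cg w) s0 u0) subrKC.
  have g1 := L2_L1_process fF gL2.
  split.
  - by move=> w; exact: (cadlag_shift s0 (cg w)).
  - move=> v v0; apply: measurable_measurable_wrt.
    by apply: (adapted_measurable fF (L1_adapted g1)); rewrite addr_ge0.
  - move=> r; have [K hK] := L1_bounded g1 (s + r); exists K => v v0 vr.
    by apply: hK; rewrite ?addr_ge0// lerD2l.
have fin (f : Omega -> R) : P.-integrable C (EFin \o f) ->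
    (\int[P]_(w in C) (f w)%:E)%E \is a fin_num by exact: integrable_fin_num.
have EM r : 0 <= r -> (\int[P]_(w in C) (compensated X p (gen j T p) r w)%:E =
    \int[P]_(w in C) (p (X r w) : R)%:E - \int[P]_(w in C) (I r w)%:E)%E.
  move=> r0; rewrite -(integralB_EFin mC (ip r r0) (iI r r0)).
  by apply: eq_integral => w _; rewrite -EFinB.
rewrite (EM t t0) (EM s s0).
exact: (fin_sube_exchange (fin _ (ip t t0)) (fin _ (ip s s0)) (fin _ (iI t t0))
  (fin _ (iI s s0)) E1).
Qed.

End polynomial_process.

(** * Predictability *)

Section predictability.
Set Implicit Arguments.
Unset Strict Implicit.
Context {R : realType} {d : measure_display} {Omega : measurableType d}.
Context (F : R -> set_system Omega).
Hypothesis fF : filtration F.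
Implicit Types (A : R -> Omega -> R) (t : R) (n : nat).

Let D : set (R * Omega) := @time_space _ Omega R.

Let S : set_system (R * Omega) := <<s D, predictable_rectangles F>>.

Let sS : sigma_algebra D S. Proof. exact: smallest_sigma_algebra. Qed.

(* The trace on [D] turns [S], a sigma-algebra on [D], into one on the whole
   type, so that the theory of measurable functions applies. *)
Let G : set_system (R * Omega) := [set C | S (D `&` C)].

Let sG : sigma_algebra setT G.
Proof.
have [S0 SC SU] := sS; split.
- by rewrite /G/= setI0.
- move=> C GC; rewrite /G/= (_ : D `&` _ = D `\` (D `&` C)); first exact: SC.
  by rewrite setTD setDIr setDv set0U setDE.
- by move=> C GC; rewrite /G/= setI_bigcupr; exact: SU.
Qed.

Let measurableG C : <<s G>> C -> G C.
Proof. by rewrite sigma_algebra_id. Qed.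

Let rect_measurable (C : set (R * Omega)) : predictable_rectangles F C ->
  measurable (C : set (g_sigma_algebraType G)).
Proof.
move=> rC; apply: sub_sigma_algebra; rewrite /G/=.
suff CD : C `<=` D by rewrite setIC (setIidl CD); exact: sub_sigma_algebra.
case: rC => [[B _ ->]|[s [t [B [s0 st _ ->]]]]] [r w] /=.
- by move=> [-> _]; split=> //=; rewrite in_itv/= lexx.
- move=> [+ _]; rewrite in_itv/= => /andP[sr _]; split=> //=.
  by rewrite in_itv/= andbT (le_trans s0)// ltW.
Qed.

(** The index of the last grid point strictly before t. The ceiling minus one, unlike the floor,
    places t in a cell open on the left and closed on the right, the shape of a predictable
    rectangle. *)
Let step n t : nat := `|Num.ceil (t * n.+1%:R) - 1|%N.

Let stepP n t : 0 < t ->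
  (step n t)%:R / n.+1%:R < t <= (step n t).+1%:R / n.+1%:R.
Proof.
move=> t0; have /andP[h1 h2] := ceil_itv (t * n.+1%:R).
have c0 : 0 <= Num.ceil (t * n.+1%:R) - 1.
  by rewrite subr_ge0 -gtz0_ge1 -(ltr_int R) (lt_le_trans _ h2)// mulr_gt0.
have cE : (step n t)%:R = (Num.ceil (t * n.+1%:R) - 1)%:~R :> R.
  by rewrite /step -[in RHS](gez0_abs c0).
rewrite ltr_pdivrMr// ler_pdivlMr// -[(step n t).+1%:R]natr1 cE h1/=.
by rewrite -[1]/(1%:~R) -intrD subrK.
Qed.

Let step_uniq n t k : k%:R / n.+1%:R < t <= k.+1%:R / n.+1%:R -> step n t = k.
Proof.
move=> /andP[h1 h2].
have t0 : 0 < t by rewrite (le_lt_trans _ h1).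
have /andP[h3 h4] := stepP n t0.
have := lt_le_trans h3 h2; have := lt_le_trans h1 h4.
rewrite !ltr_pM2r ?invr_gt0// !ltr_nat !ltnS => kt tk.
by apply/eqP; rewrite eqn_leq tk kt.
Qed.

(** Sample A at the last grid point strictly before t, and at 0 when t = 0. The value on a cell is
    then known at its left end, so preimages are countable unions of predictable rectangles;
    left-continuity gives convergence as the grid is refined. *)
Lemma left_continuous_predictable A : adapted F A ->
  (forall w t, 0 < t -> A s w @[s --> t^'-] --> A t w) -> predictable F A.
Proof.
move=> aA lA.
have FA t (B : set R) : 0 <= t -> measurable B -> F t (A t @^-1` B).
  move=> t0 mB; rewrite -(sigma_algebra_id (filtration_sigma fF t0)).
  by have := aA t t0 measurableT B mB; rewrite setTI.
pose An n (z : g_sigma_algebraType G) : R :=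
  if z.1 == 0 then A 0 z.2 else A ((step n z.1)%:R / n.+1%:R) z.2.
have mAn n : measurable_fun (D : set (g_sigma_algebraType G)) (An n).
  move=> _ B mB.
  rewrite (_ : _ `&` _ = [set 0] `*` (A 0 @^-1` B) `|` \bigcup_(k : nat)
     (`]k%:R / n.+1%:R, k.+1%:R / n.+1%:R] `*` (A (k%:R / n.+1%:R) @^-1` B))).
    apply: measurableU.
      by apply: rect_measurable; left; exists (A 0 @^-1` B) => //; exact: FA.
    apply: bigcupT_measurable => k; apply: rect_measurable; right.
    exists (k%:R / n.+1%:R), (k.+1%:R / n.+1%:R), (A (k%:R / n.+1%:R) @^-1` B).
    split=> //; first by rewrite ler_pM2r// ler_nat.
    exact: FA.
  apply/seteqP; split=> [[t w] [[/=]]|[t w] /= [[-> AB]|[k _ [/=]]]].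
  - rewrite in_itv/= andbT le_eqVlt => /predU1P[<- _|t0 _].
      by rewrite /An/= eqxx => AB; left.
    rewrite /An/= gt_eqF// => AB; right; exists (step n t) => //; split=> //=.
    by rewrite in_itv/= stepP.
  - by split; [split=> //=; rewrite in_itv/= lexx|rewrite /An/= eqxx].
  - rewrite in_itv/= => kt AB; have t0 : 0 < t.
      by case/andP: kt => kt _; rewrite (le_lt_trans _ kt).
    split; first by split=> //=; rewrite in_itv/= andbT ltW.
    by rewrite /An/= gt_eqF// (step_uniq kt).
have mD : measurable (D : set (g_sigma_algebraType G)).
  by apply: sub_sigma_algebra; rewrite /G/= setIid -[D]setD0; have [S0 + _] := sS; apply.
have mA : measurable_fun (D : set (g_sigma_algebraType G)) (fun z => A z.1 z.2).
  apply: (@measurable_fun_cvg _ _ _ _ An) => // -[t w] [/=].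
  rewrite in_itv/= andbT le_eqVlt => /predU1P[<- _|t0 _].
    by rewrite /An/= eqxx; exact: cvg_cst.
  rewrite /An/= gt_eqF//.
  apply: (proj1 (cvg_at_leftP _ _ _) (lA w t t0) (fun n => (step n t)%:R / n.+1%:R)).
  split=> [n|]; first by have /andP[] := stepP n t0.
  apply: (@squeeze_cvgr _ _ _ _ (fun n => t - harmonic n) (fun=> t)).
  - apply: nearW => n; have /andP[h1 h2] := stepP n t0.
    apply/andP; split; last exact: ltW.
    rewrite /harmonic/= lerBlDr (le_trans h2)//.
    by rewrite -[(step n t).+1%:R]natr1 mulrDl mul1r.
  - by rewrite -[X in _ --> X]subr0; apply: cvgB; [exact: cvg_cst|exact: cvg_harmonic].
  - exact: cvg_cst.
move=> B mB; have /measurableG := mA mD B mB.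
by rewrite /G/= setIA setIid.
Qed.

End predictability.

Theorem theorem7p5 (R : realType)
    (d : measure_display) (Omega : measurableType d) (P : probability Omega R)
    (F : R -> set_system Omega) (hF : filtration F)
    (E : Type) (hE : inhabited E)
    (Pol : set (E -> R^o)) (deg : (E -> R^o) -> nat)
    (hPol : polynomial_space Pol deg)
    (L : set (E -> R^o))
    (hL : complement_in (pol_le Pol deg 1) (pol_le Pol deg 0) L)
    (T : R -> (E -> R^o) -> (E -> R^o)) (hT : polynomial_action Pol deg T)
    (X : R -> Omega -> E) (hX : polynomial_process F P Pol T X)
    (B : completeNormedModType R) (j : {linear B -> (E -> R^o)})
    (hA : standing_assumption P Pol deg T X j)
    (p q : E -> R^o)
    (hp : (gen_dom j T `&` L) p) (hq : (gen_dom j T `&` L) q)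
    (hpq : gen_dom j T (p \* q)) :
  predictable_covariation F P
    (compensated X p (gen j T p)) (compensated X q (gen j T q))
    (fun t w => \int[lebesgue_measure]_(s in `[0, t])
       (carre_du_champ j T p q (X s w) : R)).
Proof.
have [_ LP1 _ _] := hL; have [Dp Lp] := hp; have [Dq Lq] := hq.
have p2 : pol_le Pol deg 2 p by exact: pol_le_leq (LP1 _ Lp).
have q2 : pol_le Pol deg 2 q by exact: pol_le_leq (LP1 _ Lq).
have pq2 : pol_le Pol deg 2 (p \* q) by exact: sa_mul1 hA _ _ (LP1 _ Lp) (LP1 _ Lq).
have L2g g : gen_dom j T g -> pol_le Pol deg 2 g ->
    L2_process P F (fun t w => gen j T g (X t w) : R).
  by move=> Dg g2; apply: (polynomial_L2 hF hT hX hA); exact: (gen_pol_le hPol hT hA).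
have Y2 := polynomial_L2 hF hT hX hA p2.
have Z2 := polynomial_L2 hF hT hX hA q2.
have u2 := L2g _ Dp p2.
have v2 := L2g _ Dq q2.
have g2 := L2g _ hpq pq2.
have Mp2 := compensated_L2 hF hPol hT hX hA Dp p2.
have Mq2 := compensated_L2 hF hPol hT hX hA Dq q2.
have Mp := compensated_martingale hF hPol hT hX hA Dp p2.
have Mq := compensated_martingale hF hPol hT hX hA Dq q2.
have Mpq := compensated_martingale hF hPol hT hX hA hpq pq2.
have a1 : L1_process P F (fun t w => carre_du_champ j T p q (X t w) : R).
  apply: (L1_processB hF (Y := fun t w => gen j T (p \* q) (X t w) - p (X t w) * gen j T q (X t w))
    (Z := fun t w => q (X t w) * gen j T p (X t w))).
    exact: (L1_processB hF (L2_L1_process hF g2) (L2_processM hF Y2 v2)).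
  exact: (L2_processM hF Z2 u2).
have ca := L1_cadlag a1.
have A1 := time_integral_L1 hF a1.
split.
- by split=> // t t0; exact: (L2_sqr_integrable hF Mp2 t0).
- by split=> // t t0; exact: (L2_sqr_integrable hF Mq2 t0).
(* A time integral is continuous in its upper bound, hence left-continuous. *)
- apply: (left_continuous_predictable hF (L1_adapted A1)) => w t _.
  by apply: cvg_at_left_filter; exact: primitive_continuous.
- exact: L1_cadlag A1.
- by move=> w; rewrite (primitive0 _ (lexx 0)).
- by move=> w t t0; exact: primitive_bounded_variation.
(* The pairing is crossed: M^p goes with Gq(X) and M^q with Gp(X). *)
have Np := martingale_integral_by_parts hF Mp Mp2 v2.
have Nq := martingale_integral_by_parts hF Mq Mq2 u2.
have := martingaleB hF (martingaleB hF Mpq Np) Nq.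
congr (martingale F P _); apply/funext => t; apply/funext => w.
exact: (compensated_product t (L2_cadlag Y2 w) (L2_cadlag Z2 w) (L2_cadlag u2 w)
  (L2_cadlag v2 w) (L2_cadlag g2 w)).
Qed.
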